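(* For any pattern $\sigma\in S_4$, the number $\#\sigma(\pi)$ of occurrences of $\sigma$ in a given permutation $\pi\in S_n$ can be computed in $\tilde{O}(n^{3/2})$ time and $\tilde{O}(n^{3/2})$ space.
   Context: A pattern $\sigma\in S_k$ occurs in $\pi\in S_n$ at positions $i_1<\dots<i_k$ if for all $j\neq j'$, $\pi(i_j)<\pi(i_{j'})$ exactly when $\sigma(j)<\sigma(j')$; $\#\sigma(\pi)$ is the number of such occurrences. $\tilde{O}(g(n))$ means $O(g(n)\log^c n)$ for some constant $c$. *)

(* Defs.v *)
From mathcomp Require Import all_boot all_order all_algebra perm.
From mathcomp Require Import reals topology normedtype sequences landau exp.
Set Implicit Arguments.
Unset Strict Implicit.
Unset Printing Implicit Defensive.
Import Order.TTheory GRing.Theory Num.Theory.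
Import numFieldNormedType.Exports.

Local Open Scope nat_scope.

(* Permutations act on {0, ..., n-1}; f lists the positions i_1 < ... < i_k. *)
Definition occurs_at (k n : nat) (sigma : 'S_k) (p : 'S_n)
    (f : {ffun 'I_k -> 'I_n}) : bool :=
  [forall j : 'I_k, forall j' : 'I_k, (j < j') ==> (f j < f j')] &&
  [forall j : 'I_k, forall j' : 'I_k,
    (j != j') ==> ((p (f j) < p (f j')) == (sigma j < sigma j'))].

Definition occ (k : nat) (sigma : 'S_k) (n : nat) (p : 'S_n) : nat :=
  #|[set f | occurs_at sigma p f]|.

(* Word RAM.  A program is a fixed finite piece of structured code over
   finitely many registers and a random-access memory.  The machine has two
   parameters: the word length w in bits (arithmetic is modulo 2 ^ w) and the
   number m of memory cells.  A program that addresses a cell >= m is stuck: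
   it has no execution. *)
Inductive binop := Add | Sub | Mul | Div | Mod | Lt | Eq.

Inductive expr :=
| Const of nat
| Reg of nat
| Read of expr
| Bin of binop & expr & expr.

Inductive cmd :=
| Skip
| Assign of nat & expr
| Write of expr & expr
| Seq of cmd & cmd
| If of expr & cmd & cmd
| While of expr & cmd.

Record state := State { regs : nat -> nat; mem : nat -> nat }.

Definition upd (f : nat -> nat) (a v : nat) : nat -> nat :=
  fun b => if b == a then v else f b.

Definition set_reg (s : state) (r v : nat) := State (upd (regs s) r v) (mem s).
Definition set_mem (s : state) (a v : nat) := State (regs s) (upd (mem s) a v).

(* As in the library, x %/ 0 = 0 and x %% 0 = x. *)
Definition binop_sem (w : nat) (op : binop) (x y : nat) : nat :=
  match op with
  | Add => x + y
  | Sub => x + (2 ^ w - y)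
  | Mul => x * y
  | Div => x %/ y
  | Mod => x %% y
  | Lt => x < y
  | Eq => x == y
  end %% 2 ^ w.

Fixpoint eval (w m : nat) (s : state) (e : expr) : option nat :=
  match e with
  | Const k => Some (k %% 2 ^ w)
  | Reg r => Some (regs s r)
  | Read a =>
      if eval w m s a is Some v then
        if v < m then Some (mem s v) else None
      else None
  | Bin op a b =>
      if eval w m s a is Some x then
        if eval w m s b is Some y then Some (binop_sem w op x y) else None
      else None
  end.

(* Unit cost for each operand, memory access and operation on words. *)
Fixpoint ecost (e : expr) : nat :=
  match e with
  | Const _ | Reg _ => 1
  | Read a => (ecost a).+1
  | Bin _ a b => (ecost a + ecost b).+1
  end.

(* exec w m c s t s' : on the machine with word length w and m cells, c run
   from s halts in s' after t time steps. *)
Inductive exec (w m : nat) : cmd -> state -> nat -> state -> Prop :=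
| ExecSkip s : exec w m Skip s 1 s
| ExecAssign s r e v :
    eval w m s e = Some v ->
    exec w m (Assign r e) s (ecost e).+1 (set_reg s r v)
| ExecWrite s a e x v :
    eval w m s a = Some x -> eval w m s e = Some v -> x < m ->
    exec w m (Write a e) s (ecost a + ecost e).+1 (set_mem s x v)
| ExecSeq s1 s2 s3 c1 c2 t1 t2 :
    exec w m c1 s1 t1 s2 -> exec w m c2 s2 t2 s3 ->
    exec w m (Seq c1 c2) s1 (t1 + t2) s3
| ExecIf s s' e c1 c2 v t :
    eval w m s e = Some v ->
    exec w m (if v != 0 then c1 else c2) s t s' ->
    exec w m (If e c1 c2) s (ecost e + t).+1 s'
| ExecWhileFalse s e c :
    eval w m s e = Some 0 ->
    exec w m (While e c) s (ecost e).+1 s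
| ExecWhileTrue s1 s2 s3 e c v t1 t2 :
    eval w m s1 e = Some v -> v != 0 ->
    exec w m c s1 t1 s2 -> exec w m (While e c) s2 t2 s3 ->
    exec w m (While e c) s1 (ecost e + t1 + t2).+1 s3.

(* n in register 0, p(0), ..., p(n-1) in cells 0, ..., n-1, zero elsewhere. *)
Definition init_state (n : nat) (p : 'S_n) : state :=
  State (fun r => if r == 0 then n else 0)
        (fun a => if insub a is Some i then nat_of_ord (p i) else 0).

(* Words have O(log n) bits: a constant multiple of the number of binary
   digits of n.  The input cells count towards the space; the result is left
   in register 0. *)
Definition computes_within (P : cmd) (f : forall n : nat, 'S_n -> nat)
    (time space : nat -> nat) : Prop :=
  exists2 K : nat, 0 < K &
  forall (n : nat) (p : 'S_n), exists (t : nat) (s : state),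
    [/\ exec (K * (trunc_log 2 n).+1) (space n) P (init_state p) t s,
        t <= time n & regs s 0 = f n p].

Local Open Scope classical_set_scope.
Local Open Scope ring_scope.

Definition soft_O (R : realType) (f : nat -> nat) (g : nat -> R) : Prop :=
  exists c : nat,
    (fun n : nat => (f n)%:R : R^o) =O_\oo
    (fun n : nat => g n * ln (n%:R : R) ^+ c : R^o).

(* Main.v *)
Require Import Defs.
From mathcomp Require Import all_boot all_order all_algebra perm.
From mathcomp Require Import reals topology normedtype sequences landau exp.
From mathcomp Require Import zify ring.
Set Implicit Arguments.
Unset Strict Implicit.
Unset Printing Implicit Defensive.
Import Order.TTheory GRing.Theory Num.Theory.
Import numFieldNormedType.Exports.
Local Open Scope nat_scope.

(** For every pattern of length 4, twelve times its number of occurrences is an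
    integer combination of statistics counting quadruples of points.  All but
    one of them are sums over the points of products of the position, the value,
    the number of inversions [v] ending at the point, and sums of such functions
    over the inversions ending at the point, together with the square of the sum
    of [v]; sweeping a tree of partial sums over the values computes these in
    O(n log n) time.  The exception is the cyclic statistic
      #{(i, j, k, l) : k < i, l < j, p k < p j, p l < p i}.
    Cut the positions into about sqrt n blocks of length about sqrt n.  If k and
    i lie in different blocks, or l and j do, then one linear pass per block
    suffices.  The remaining pairs (k, i) and (l, j) lie inside blocks, so there
    are O(n^(3/2)) of them, and they are matched by one sweep over the values.

    That the combination is correct depends only on the relative order of the at
    most four points involved, hence is checked on the permutations of size at
    most 4. *)

(** The four inequalities of the cyclic statistic form a 4-cycle through i, k, j, l, alternating
    between positions and values: summing out any point leaves a function of two others. The other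
    statistics have acyclic constraints and are summed out leaf by leaf. Blocks of length B turn a
    comparison of positions into a test against a block. The far part then costs O(n) for each of B
    blocks and the near part O(log n) for each of about n B pairs, so B near sqrt n balances the
    two.

    Some coefficients are negative, so the program keeps a positive and a negative total, both only
    modulo the word size. Overflow in them is harmless: their difference is exactly 12 times the
    answer, at most 12 n^4, and this fits in a word. *)

(** * Statistics of four-point configurations *)

(* A kind relates a point b to a point a.  The number of points b related to a
   is 1, n, the position of a, the value of a, and the number of inversions
   ending at a, respectively. *)
Inductive kind := One | Tot | Pos | Val | Inv.

Definition ksat (T : eqType) (lx ly : rel T) (k : kind) (a b : T) : bool :=
  match k with
  | One => b == a
  | Tot => true
  | Pos => lx b a
  | Val => ly b a
  | Inv => lx b a && ly a b
  end.

(** The constructors are the shapes of the constraint graph on a, b, c, d: a 4-cycle, two disjoint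
    inversions, a path b - a - c - d whose middle edge is an inversion, and a star centred at a. *)
Inductive stat :=
| Cyc
| Sq
| Path of kind & kind
| Star of kind & kind & kind.

Definition ssat (T : eqType) (lx ly : rel T) (st : stat) (a b c d : T) : bool :=
  match st with
  | Cyc => [&& lx b a, lx d c, ly b c & ly d a]
  | Sq => ksat lx ly Inv a b && ksat lx ly Inv c d
  | Path k g => [&& ksat lx ly k a b, ksat lx ly Inv a c & ksat lx ly g c d]
  | Star k1 k2 k3 =>
      [&& ksat lx ly k1 a b, ksat lx ly k2 a c & ksat lx ly k3 a d]
  end.

(** The order is that of the columns of [coeffs]. Points of a configuration may coincide; the
    entries with [One], which glues a point to the centre, make it possible to correct for this. *)
Definition stats : seq stat :=
  [:: Cyc; Sq; Path Pos Pos; Path Inv Pos; Path Pos Val; Path Val Val;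
      Path Inv Val; Path Pos Inv; Path Val Inv; Path Inv Inv;
      Star One One Inv; Star One Tot Inv; Star One Pos Val;
      Star One Pos Inv; Star One Val Val; Star One Val Inv;
      Star One Inv Inv; Star Tot Tot Inv; Star Tot Pos Val;
      Star Tot Pos Inv; Star Tot Val Val; Star Tot Val Inv;
      Star Tot Inv Inv; Star Pos Pos Val; Star Pos Pos Inv;
      Star Pos Val Val; Star Pos Val Inv; Star Pos Inv Inv;
      Star Val Val Val; Star Val Val Inv; Star Val Inv Inv;
      Star Inv Inv Inv].

Definition combine (cs : seq nat) (F : stat -> nat) : nat :=
  sumn [seq x.1 * F x.2 | x <- zip cs stats].

(* The row of a pattern expresses 12 times its number of occurrences in terms of
   [stats]; it solves the linear system given by the values of the statistics on
   all permutations of size at most 4. *)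
Definition coeffs : seq (seq nat * seq int) :=
  [:: ([:: 0; 1; 2; 3]%N, [:: 0; 6; 0; 12; 12; 0; -12; 0; 0; -12; -12; 18; 18; 18;
        -36; -18; -18; -6; -12; -12; 36; 12; 12; 0; -6; 6; 0; 0; -36; -6; 0; 0]);
      ([:: 0; 1; 3; 2]%N, [:: 0; -6; 0; -12; -12; 0; 12; 0; 0; 12; 0; 0; 0; 0; 0;
        0; 0; 0; 0; 0; 0; 0; 0; 0; 6; 0; 12; 6; 0; 0; -12; -6]);
      ([:: 0; 2; 1; 3]%N, [:: 3; 0; -6; 0; 0; -6; 0; 0; 0; 0; -1; 6; 6; -6; -3;
        -6; 0; 0; 6; 12; -12; 0; -6; 6; 6; -6; -12; -6; 6; 6; 6; 4]);
      ([:: 0; 2; 3; 1]%N, [:: -3; 0; 6; 0; 0; -6; 0; 0; -12; 0; -5; 0; -12; 0; 9;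
        -6; 0; 0; 6; 0; 0; 0; 0; 0; 0; -6; -12; -6; 0; 12; 12; 2]);
      ([:: 0; 3; 1; 2]%N, [:: -3; 0; 6; -12; -12; 6; 0; 0; 0; 0; -5; 0; -18; -6;
        15; 0; 0; 0; 6; 0; 0; 0; 0; -12; -6; 0; 12; 6; 6; -6; 0; 2]);
      ([:: 0; 3; 2; 1]%N, [:: 3; 0; -6; 12; 12; 6; 0; 0; 12; 0; 1; 0; 6; -6; -3;
        6; 6; 0; -6; 0; 0; 0; 0; 6; 0; 6; 0; 0; -6; -12; -12; -4]);
      ([:: 1; 0; 2; 3]%N, [:: 0; -6; 0; -12; -12; 0; 12; 0; 0; 12; 6; -12; -12; 0;
        12; 12; 6; 6; 12; 0; -12; -12; -6; -6; 0; -6; 12; 12; 12; 6; -6; -6]);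
      ([:: 1; 0; 3; 2]%N, [:: 0; 6; 0; 12; 24; 0; -12; 0; 0; -12; -2; 0; 0; 0; 0;
        0; 0; 0; 0; 0; 0; 0; 0; 12; 0; 0; -24; -12; -12; 0; 12; 8]);
      ([:: 1; 2; 0; 3]%N, [:: -3; 0; -6; 0; 0; 6; 0; 12; 0; 0; 1; -6; -12; -6; 9;
        12; 6; 0; 6; 12; 0; -12; -6; 6; 12; 0; -12; -12; -12; 0; 6; 2]);
      ([:: 1; 2; 3; 0]%N, [:: 3; 0; 6; 0; 0; 6; 0; -12; 12; 0; 5; 0; 6; -12; -3;
        12; 6; 0; -6; 0; 0; 0; 0; 0; -6; 0; 0; 0; 6; -6; 0; 4]);
      ([:: 1; 3; 0; 2]%N, [:: 3; 0; 6; 0; -12; -6; 0; 0; 0; 0; 3; 0; 6; 0; -3; 0;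
        0; 0; -6; 0; 0; 0; 0; -12; -6; 0; 12; 0; 18; 6; 0; 0]);
      ([:: 1; 3; 2; 0]%N, [:: -3; 0; -6; 0; 0; -6; 0; 0; -12; 0; -1; 0; -6; 0; 3;
        0; 0; 0; 6; 0; 0; 0; 0; 0; 0; 0; 0; 6; -6; 12; 6; -2]);
      ([:: 2; 0; 1; 3]%N, [:: -3; 0; 6; 0; -12; 6; 12; 0; 0; 0; 1; -6; -6; 0; 3;
        6; 6; 0; -6; 0; 12; 0; -6; -6; -6; 6; 12; 0; -6; -6; -6; 2]);
      ([:: 2; 0; 3; 1]%N, [:: 3; 0; -6; 0; -12; 6; 0; 0; 0; 0; 3; 0; 6; 0; -3; 0;
        0; 0; -6; 0; 0; 0; 0; -6; 6; 6; 12; 0; 6; -6; 0; 0]);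
      ([:: 2; 1; 0; 3]%N, [:: 3; 0; 6; 0; 12; -6; -12; -12; 0; 0; 1; 0; 6; 6; -3;
        -6; -6; 0; -6; -12; 0; 12; 12; 0; -12; 0; 0; 12; 6; 0; 0; -4]);
      ([:: 2; 1; 3; 0]%N, [:: -3; 0; -6; 0; 0; -6; 0; 12; 0; 0; -1; 0; -6; 0; 3;
        0; 0; 0; 6; 0; 0; 0; 0; 0; 12; 0; 0; -6; -6; 0; -6; -2]);
      ([:: 2; 3; 0; 1]%N, [:: 0; 0; 0; 0; 12; 0; 0; -12; 12; 12; 2; 0; 6; -6; -6;
        6; 6; 0; 0; 0; 0; 0; 0; 6; -6; 0; 0; 12; -6; -6; -12; -8]);
      ([:: 2; 3; 1; 0]%N, [:: 0; 0; 0; 0; 0; 0; 0; 12; -12; -12; 0; 0; 0; 6; 0;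
        -6; -6; 0; 0; 0; 0; 0; 0; 0; 0; 0; 0; -6; 0; 0; 6; 6]);
      ([:: 3; 0; 1; 2]%N, [:: 3; 0; -6; 12; 24; -6; -12; 0; 0; 0; 5; 0; 18; 0;
        -15; 0; 6; 0; -6; 0; 0; 0; 0; 12; 6; 0; -24; -12; -6; 6; 12; 4]);
      ([:: 3; 0; 2; 1]%N, [:: -3; 0; 6; -12; -12; -6; 0; 0; 0; 0; -1; 0; -6; 0; 3;
        0; 0; 0; 6; 0; 0; 0; 0; -6; -6; -6; 12; 12; 6; 6; 0; -2]);
      ([:: 3; 1; 0; 2]%N, [:: -3; 0; -6; 0; -12; 6; 12; 0; 0; 0; -1; 0; -6; 0; 3;
        0; 0; 0; 6; 0; 0; 0; 0; 0; 6; 0; 12; 0; -6; -6; -12; -2]);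
      ([:: 3; 1; 2; 0]%N, [:: 3; 0; 6; 0; 0; 6; 0; 0; 0; 0; 1; 0; 6; 6; -3; -6;
        -6; 0; -6; 0; 0; 0; 0; 0; -6; 0; 0; 6; 6; -6; -6; -4]);
      ([:: 3; 2; 0; 1]%N, [:: 0; 0; 0; 0; 0; 0; 0; 12; -12; -12; 0; 0; 0; 6; 0;
        -6; -6; 0; 0; 0; 0; 0; 0; 0; 6; 0; -12; -12; 0; 6; 12; 6]);
      ([:: 3; 2; 1; 0]%N, [:: 0; 0; 0; 0; 0; 0; 0; -12; 12; 12; 0; 0; 0; 0; 0; 0;
        0; 0; 0; 0; 0; 0; 0; 0; 0; 0; 0; 0; 0; 0; 0; 0])]%Z.

Definition row (s : seq nat) : seq int :=
  (nth ([::], [::]) coeffs (index s (unzip1 coeffs))).2.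
(** Splitting a row by sign keeps the identity in the natural numbers, where subtraction truncates.
    [Negz m] stands for -(m + 1). *)
Definition pos_row (s : seq nat) : seq nat :=
  [seq if z is Posz m then m else 0 | z <- row s].
Definition neg_row (s : seq nat) : seq nat :=
  [seq if z is Negz m then m.+1 else 0 | z <- row s].

Definition osat (T : eqType) (lx ly : rel T) (s : seq nat) (a b c d : T) : bool :=
  let r i j := nth 0 s i < nth 0 s j in
  [&& lx a b, lx b c, lx c d, ly a b == r 0 1, ly a c == r 0 2, ly a d == r 0 3,
      ly b c == r 1 2, ly b d == r 1 3 & ly c d == r 2 3].

Definition word (sigma : 'S_4) : seq nat := [seq nat_of_ord (sigma i) | i <- enum 'I_4].

Definition onto (k a b c d : nat) : bool := all (mem [:: a; b; c; d]) (iota 0 k).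

Definition sum_onto (k : nat) (F : nat -> nat -> nat -> nat -> nat) : nat :=
  let I := iota 0 k in
  sumn [seq sumn [seq sumn [seq sumn [seq if onto k a b c d then F a b c d else 0
    | d <- I] | c <- I] | b <- I] | a <- I].

Definition small_identity (s : seq nat) (k : nat) (tau : seq nat) : bool :=
  let ly i j := nth 0 tau i < nth 0 tau j in
  sum_onto k (fun a b c d => combine (pos_row s) (fun st => ssat ltn ly st a b c d))
  == sum_onto k (fun a b c d => combine (neg_row s) (fun st => ssat ltn ly st a b c d)
       + 12 * osat ltn ly s a b c d).

(** Tuples onto fewer than four points are included: the coefficients must make the degenerate
    configurations cancel as well. *)
Lemma small_identities :
  all (fun s => all (fun k => all (small_identity s k) (permutations (iota 0 k)))
    (iota 1 4)) (permutations (iota 0 4)).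
Proof. by vm_compute. Qed.

(** * Reduction of the identity to at most four points *)

Notation o0 := (@Ordinal 4 0 isT).
Notation o1 := (@Ordinal 4 1 isT).
Notation o2 := (@Ordinal 4 2 isT).
Notation o3 := (@Ordinal 4 3 isT).

Definition xlt n : rel 'I_n := fun a b => a < b.
Definition ylt n (p : 'S_n) : rel 'I_n := fun a b => p a < p b.

Definition stat_count n (p : 'S_n) (st : stat) : nat :=
  \sum_(f : {ffun 'I_4 -> 'I_n}) ssat (@xlt n) (ylt p) st (f o0) (f o1) (f o2) (f o3).

Lemma enum_I4 : enum 'I_4 = [:: o0; o1; o2; o3].
Proof. by apply: (inj_map val_inj); rewrite val_enum_ord. Qed.

Lemma forall_I4 (P : pred 'I_4) : [forall i, P i] = [&& P o0, P o1, P o2 & P o3].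
Proof.
apply/forallP/and4P => [H|[H0 H1 H2 H3] i]; first by split.
have: i \in enum 'I_4 by rewrite mem_enum.
by rewrite enum_I4 !inE => /or4P [] /eqP ->.
Qed.

Lemma combine_sum (T : finType) (Q : pred T) (cs : seq nat) (F : T -> stat -> nat) :
  \sum_(t | Q t) combine cs (F t) = combine cs (fun st => \sum_(t | Q t) F t st).
Proof.
rewrite /combine; elim: (zip cs stats) => [|x l IH] /=; first by rewrite big1.
by rewrite big_split /= IH big_distrr.
Qed.

Lemma eq_combine (cs : seq nat) (F G : stat -> nat) :
  F =1 G -> combine cs F = combine cs G.
Proof. by move=> FG; congr sumn; apply: eq_map => x; rewrite FG. Qed.

Lemma word_permutation (sigma : 'S_4) : word sigma \in permutations (iota 0 4).
Proof.
rewrite mem_permutations; apply: uniq_perm; last 2 first.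
- exact: iota_uniq.
- move=> i; rewrite mem_iota /=; apply/mapP/idP => [[j _ ->]|lt_i]; first exact: ltn_ord.
  exists ((sigma^-1)%g (Ordinal lt_i)); first by rewrite mem_enum.
  by rewrite permKV.
by rewrite map_inj_uniq ?enum_uniq // => i j /val_inj /perm_inj.
Qed.

(** [occurs_at] compares values for all ordered pairs, [osat] only for the six increasing ones; the
    reversed comparisons follow from the injectivity of p and sigma. *)
Lemma occurs_osat n (p : 'S_n) (sigma : 'S_4) (f : {ffun 'I_4 -> 'I_n}) :
  occurs_at sigma p f = osat (@xlt n) (ylt p) (word sigma) (f o0) (f o1) (f o2) (f o3).
Proof.
have W (i : 'I_4) : nth 0 (word sigma) i = sigma i.
  by rewrite (nth_map o0) ?size_enum_ord // nth_ord_enum.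
rewrite /osat /xlt /ylt (W o0) (W o1) (W o2) (W o3) /occurs_at !forall_I4 /=.
have anti (i j : 'I_4) : f i < f j -> (p (f j) < p (f i)) = ~~ (p (f i) < p (f j)).
  move=> lt_ij; rewrite -leqNgt [RHS]leq_eqVlt; case: eqP => // /val_inj /perm_inj e.
  by rewrite e ltnn in lt_ij.
have santi (i j : 'I_4) : i != j -> (sigma j < sigma i) = ~~ (sigma i < sigma j).
  move=> ne; rewrite -leqNgt [RHS]leq_eqVlt; case: eqP => // /val_inj /perm_inj e.
  by rewrite e eqxx in ne.
rewrite ?andbT /=.
(* If the four positions are not increasing, both sides are false. *)
case L01: (f o0 < f o1); rewrite ?andbF ?andFb //=.
case L12: (f o1 < f o2); rewrite ?andbF ?andFb //=.
case L23: (f o2 < f o3); rewrite ?andbF ?andFb //=.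
have L02 := ltn_trans L01 L12; have L03 := ltn_trans L02 L23.
have L13 := ltn_trans L12 L23.
rewrite L02 L03 L13 /= (anti _ _ L01) (anti _ _ L02) (anti _ _ L03) (anti _ _ L12)
  (anti _ _ L13) (anti _ _ L23) (santi o0 o1) // (santi o0 o2) // (santi o0 o3) //
  (santi o1 o2) // (santi o1 o3) // (santi o2 o3) // !eqb_negLR !negbK.
by do !case: (_ == _).
Qed.

Lemma sum_ffun4 (T : finType) (F : T -> T -> T -> T -> nat) :
  \sum_(f : {ffun 'I_4 -> T}) F (f o0) (f o1) (f o2) (f o3) =
  \sum_a \sum_b \sum_c \sum_d F a b c d.
Proof.
rewrite pair_bigA pair_bigA pair_bigA /=.
pose mk (t : T * T * T * T) : {ffun 'I_4 -> T} :=
  [ffun i : 'I_4 => nth t.1.1.1 [:: t.1.1.1; t.1.1.2; t.1.2; t.2] i].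
rewrite (reindex mk) /=; last first.
  exists (fun f : {ffun 'I_4 -> T} => (f o0, f o1, f o2, f o3)) => [[[[a b] c] d] _|f _].
    by rewrite !ffunE.
  apply/ffunP => i; rewrite ffunE /=.
  have: i \in enum 'I_4 by rewrite mem_enum.
  by rewrite enum_I4 !inE => /or4P [] /eqP ->.
by apply: eq_bigr => [[[[a b] c] d] _]; rewrite !ffunE.
Qed.

Lemma sum_ord_iota k (F : nat -> nat) : \sum_(i < k) F i = sumn [seq F i | i <- iota 0 k].
Proof. by rewrite sumnE big_map -(big_mkord xpredT) /index_iota subn0. Qed.

Lemma sum_ontoE k (F : nat -> nat -> nat -> nat -> nat) :
  \sum_(g : {ffun 'I_4 -> 'I_k} | g @: setT == setT) F (g o0) (g o1) (g o2) (g o3) =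
  sum_onto k F.
Proof.
have onE (g : {ffun 'I_4 -> 'I_k}) :
    (g @: setT == setT) = onto k (g o0) (g o1) (g o2) (g o3).
  apply/eqP/allP => [e i|H].
    rewrite mem_iota /= => lt_i.
    have: Ordinal lt_i \in g @: setT by rewrite e inE.
    case/imsetP => j _ /(congr1 val) /= ->.
    have: j \in enum 'I_4 by rewrite mem_enum.
    by rewrite enum_I4 !inE => /or4P [] /eqP ->; rewrite eqxx ?orbT.
  apply/eqP; rewrite eqEsubset subsetT /=; apply/subsetP => i _.
  have := H i; rewrite mem_iota /= ltn_ord !inE => /(_ isT) /or4P [] /eqP /val_inj ->;
  exact: imset_f.
rewrite big_mkcond /=.
under eq_bigr => g _ do rewrite onE.
rewrite (sum_ffun4 (fun a b c d : 'I_k => if onto k a b c d then F a b c d else 0)).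
rewrite /sum_onto -sum_ord_iota; apply: eq_bigr => a _.
rewrite -sum_ord_iota; apply: eq_bigr => b _.
rewrite -sum_ord_iota; apply: eq_bigr => c _.
by rewrite -sum_ord_iota.
Qed.

(** The enumeration of B is a subsequence of 0, ..., n-1, hence increasing. Renaming the positions
    in B by their ranks therefore preserves their order. *)
Lemma enum_val_ltn n (B : {set 'I_n}) (i j : 'I_#|B|) :
  (enum_val i < enum_val j) = (i < j).
Proof.
have x0 : 'I_n by case: i => i /=; case: (pickP (mem B)) => // /eq_card0 ->.
rewrite !(enum_val_nth x0).
have S : sorted ltn [seq nat_of_ord x | x <- enum B].
  rewrite {1}/enum_mem -enumT.
  apply: (@subseq_sorted _ ltn _ _ [seq nat_of_ord x | x <- enum 'I_n]).
  - exact: ltn_trans.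
  - by apply: map_subseq; apply: filter_subseq.
  - by rewrite val_enum_ord; apply: iota_ltn_sorted.
have SZ : size [seq nat_of_ord x | x <- enum B] = #|B| by rewrite size_map -cardE.
have := @sorted_ltn_nth _ ltn ltn_trans 0 _ S.
move=> /(_ i j) /[!inE] /[!SZ] /(_ (ltn_ord i) (ltn_ord j)) A1.
have := @sorted_ltn_nth _ ltn ltn_trans 0 _ S.
move=> /(_ j i) /[!inE] /[!SZ] /(_ (ltn_ord j) (ltn_ord i)) A2.
rewrite !(nth_map x0) -?cardE ?ltn_ord // in A1 A2.
case: (ltngtP i j) => [lt|gt|eq]; first exact: A1.
  by apply/negbTE; rewrite -leqNgt; apply: ltnW; apply: A2.
by rewrite eq ltnn.
Qed.

(** Each value is replaced by its rank, the number of smaller values. *)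
Lemma standardization k (v : 'I_k -> nat) : injective v ->
  exists2 tau : seq nat, tau \in permutations (iota 0 k) &
    forall i j : 'I_k, (nth 0 tau i < nth 0 tau j) = (v i < v j).
Proof.
move=> v_inj; pose rk (i : 'I_k) := #|[set j | v j < v i]|.
have rk_lt i : rk i < k.
  rewrite -[X in _ < X](card_ord k) -cardsT; apply: proper_card; apply/properP.
  by split; [exact: subsetT | exists i; rewrite !inE ?ltnn].
have rk_mono i j : v i < v j -> rk i < rk j.
  move=> lt; apply: proper_card; apply/properP; split.
    by apply/subsetP => l; rewrite !inE => /ltn_trans; apply.
  by exists i; rewrite !inE ?ltnn.
have rkE i j : (rk i < rk j) = (v i < v j).
  case: (ltngtP (v i) (v j)) => [/rk_mono //|/rk_mono lt|/v_inj ->]; last exact: ltnn.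
  by rewrite ltnNge ltnW.
exists [seq rk i | i <- enum 'I_k]; last first.
  have nthE (i : 'I_k) : nth 0 [seq rk i | i <- enum 'I_k] i = rk i.
    by rewrite (nth_map i) ?size_enum_ord // nth_ord_enum.
  by move=> i j; rewrite !nthE rkE.
rewrite mem_permutations perm_sym.
have U : uniq [seq rk i | i <- enum 'I_k].
  rewrite map_inj_uniq ?enum_uniq // => i j e; apply: v_inj.
  by case: (ltngtP (v i) (v j)) => // /rk_mono; rewrite e ltnn.
rewrite perm_sym; apply: uniq_perm => //; first exact: iota_uniq.
have sub : {subset [seq rk i | i <- enum 'I_k] <= iota 0 k}.
  by move=> x /mapP [i _ ->]; rewrite mem_iota /=.
by apply: (uniq_min_size U sub _).2; rewrite size_iota size_map size_enum_ord.
Qed.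

(* Tuples are grouped by the set B of their positions; the tuples with image B
   are counted by the finite check on the pattern induced by p on B. *)
Lemma pattern_identity n (p : 'S_n) (sigma : 'S_4) :
  combine (pos_row (word sigma)) (stat_count p) =
  combine (neg_row (word sigma)) (stat_count p) + 12 * occ sigma p.
Proof.
have -> : occ sigma p = \sum_(f : {ffun 'I_4 -> 'I_n})
    osat (@xlt n) (ylt p) (word sigma) (f o0) (f o1) (f o2) (f o3).
  rewrite /occ -sum1dep_card big_mkcond /=; apply: eq_bigr => f _.
  by rewrite -occurs_osat; case: occurs_at.
rewrite big_distrr /= -!combine_sum -big_split /=.
rewrite (partition_big (fun f : {ffun 'I_4 -> 'I_n} => f @: setT) xpredT) //=.
rewrite [RHS](partition_big (fun f : {ffun 'I_4 -> 'I_n} => f @: setT) xpredT) //=.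
apply: eq_bigr => B _.
have [szB|/negP szB] := boolP (#|B| \in iota 1 4); last first.
  have noB (f : {ffun 'I_4 -> 'I_n}) : (f @: setT == B) = false.
    apply/negP => /eqP fB; apply: szB.
    rewrite mem_iota -fB card_gt0; apply/andP; split.
      by apply/set0Pn; exists (f o0); apply: imset_f.
    by apply: leq_trans (leq_imset_card _ _) _; rewrite cardsT card_ord.
  by rewrite !big_pred0.
pose e (i : 'I_#|B|) : 'I_n := enum_val i.
have [tau tauP tauE] : exists2 tau : seq nat, tau \in permutations (iota 0 #|B|) &
    forall i j : 'I_#|B|, (nth 0 tau i < nth 0 tau j) = (p (e i) < p (e j)).
  apply: (standardization (v := fun i => p (e i))) => i j /val_inj /perm_inj.
  exact: enum_val_inj.
have := small_identities => /allP /(_ _ (word_permutation sigma)) /allP /(_ _ szB)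
  /allP /(_ _ tauP) /eqP.
set F := (X in sum_onto _ X = _); set G := (X in _ = sum_onto _ X) => FG.
(* Composition with the increasing enumeration e is a bijection from the surjections onto ['I_#|B|]
   to the tuples with image B. *)
have reindexB (H : 'I_n -> 'I_n -> 'I_n -> 'I_n -> nat)
    (H' : nat -> nat -> nat -> nat -> nat) :
  (forall a b c d : 'I_#|B|, H (e a) (e b) (e c) (e d) = H' a b c d) ->
  \sum_(f : {ffun 'I_4 -> 'I_n} | f @: setT == B) H (f o0) (f o1) (f o2) (f o3) =
  sum_onto #|B| H'.
  move=> HH; rewrite -sum_ontoE.
  pose mk (g : {ffun 'I_4 -> 'I_#|B|}) : {ffun 'I_4 -> 'I_n} := [ffun i => e (g i)].
  have i0 : 'I_#|B| by move: szB; rewrite mem_iota => /andP [h _]; exact: Ordinal h.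
  have Bx : e i0 \in B by exact: enum_valP.
  pose un (f : {ffun 'I_4 -> 'I_n}) : {ffun 'I_4 -> 'I_#|B|} :=
    [ffun i => enum_rank_in Bx (f i)].
  rewrite (reindex_onto mk un) /=; last first.
    move=> f /eqP fB; apply/ffunP => i; rewrite !ffunE /e enum_rankK_in // -fB.
    exact: imset_f.
  apply: eq_big => [g|g _]; last by rewrite !ffunE HH.
  have unK : un (mk g) = g.
    by apply/ffunP => i; rewrite !ffunE /e enum_valK_in.
  rewrite unK eqxx andbT.
  apply/eqP/eqP => [eB|eT].
    apply/setP => i; rewrite inE; have: e i \in mk g @: setT by rewrite eB enum_valP.
    case/imsetP => j _; rewrite ffunE => /enum_val_inj ->; exact: imset_f.
  apply/setP => x; apply/imsetP/idP => [[j _ ->]|xB]; first by rewrite ffunE enum_valP.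
  have: enum_rank_in Bx x \in g @: setT by rewrite eT inE.
  case/imsetP => j _ ej; exists j => //.
  by rewrite ffunE -ej /e enum_rankK_in.
have kE k (a b : 'I_#|B|) : ksat (@xlt n) (ylt p) k (e a) (e b) =
    ksat ltn (fun i j => nth 0 tau i < nth 0 tau j) k (a : nat) (b : nat).
  by case: k; rewrite /= ?/xlt ?/ylt ?enum_val_ltn ?tauE ?(inj_eq enum_val_inj).
have sE st (a b c d : 'I_#|B|) : ssat (@xlt n) (ylt p) st (e a) (e b) (e c) (e d) =
    ssat ltn (fun i j => nth 0 tau i < nth 0 tau j) st (a : nat) (b : nat) (c : nat) (d : nat).
  by case: st => [||k g|k1 k2 k3]; rewrite /ssat ?kE // /xlt /ylt !enum_val_ltn !tauE.
have oE s (a b c d : 'I_#|B|) : osat (@xlt n) (ylt p) s (e a) (e b) (e c) (e d) =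
    osat ltn (fun i j => nth 0 tau i < nth 0 tau j) s (a : nat) (b : nat) (c : nat) (d : nat).
  by rewrite /osat /xlt /ylt !enum_val_ltn !tauE.
rewrite (reindexB (fun a b c d => combine (pos_row (word sigma))
  (fun st => ssat (@xlt n) (ylt p) st a b c d)) F); last first.
  by move=> a b c d; apply: eq_combine => st; rewrite sE.
rewrite FG; apply/esym.
apply: (reindexB (fun a b c d => combine (neg_row (word sigma))
  (fun st => ssat (@xlt n) (ylt p) st a b c d) +
  12 * osat (@xlt n) (ylt p) (word sigma) a b c d) G) => a b c d.
by rewrite oE; congr (_ + _); apply: eq_combine => st; rewrite sE.
Qed.

(** * Values of the statistics *)

(** The extension by 0 is exactly the initial memory of [init_state]. *)
Definition pfun n (p : 'S_n) (i : nat) : nat :=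
  if insub i is Some j then nat_of_ord (p j) else 0.

Definition inv_sum (n : nat) (f g : nat -> nat) (i : nat) : nat :=
  \sum_(0 <= k < n) ((k < i) && (f i < f k)) * g k.

Definition kind_val (n : nat) (f : nat -> nat) (k : kind) (i : nat) : nat :=
  match k with
  | One => 1
  | Tot => n
  | Pos => i
  | Val => f i
  | Inv => inv_sum n f (fun=> 1) i
  end.

Definition below_left (n : nat) (f : nat -> nat) (i j : nat) : nat :=
  \sum_(0 <= k < n) ((k < i) && (f k < f j)).

(** Once the opposite corners i and j of the cycle are fixed, k and l are constrained independently,
    which gives a product. *)
Definition cyc (n : nat) (f : nat -> nat) : nat :=
  \sum_(0 <= i < n) \sum_(0 <= j < n) below_left n f i j * below_left n f j i.

Definition stat_val (n : nat) (f : nat -> nat) (st : stat) : nat :=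
  match st with
  | Cyc => cyc n f
  | Sq => (\sum_(0 <= i < n) kind_val n f Inv i) * (\sum_(0 <= i < n) kind_val n f Inv i)
  | Path k g => \sum_(0 <= i < n) kind_val n f k i * inv_sum n f (kind_val n f g) i
  | Star k1 k2 k3 =>
      \sum_(0 <= i < n) kind_val n f k1 i * kind_val n f k2 i * kind_val n f k3 i
  end.

Lemma pfunE n (p : 'S_n) (i : 'I_n) : pfun p i = p i.
Proof. by rewrite /pfun valK. Qed.

Lemma sum_ltn n a : a <= n -> \sum_(0 <= i < n) (i < a) = a.
Proof.
move=> le; rewrite (big_cat_nat_idem (addn0 _) (leq0n a) le) //=.
rewrite (eq_big_nat _ _ (F2 := fun=> 1)) => [|i /andP[_ ->]] //.
rewrite sum_nat_const_nat subn0 muln1 (eq_big_nat _ _ (F2 := fun=> 0)).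
  by rewrite big1_eq addn0.
by move=> i /andP [le_ai _]; rewrite ltnNge le_ai.
Qed.

Lemma kind_valE n (p : 'S_n) (k : kind) (a : 'I_n) :
  \sum_(b < n) ksat (@xlt n) (ylt p) k a b = kind_val n (pfun p) k a.
Proof.
case: k => /=.
- rewrite (bigD1 a) //= eqxx big1 // => b /negbTE -> //.
- by rewrite sum_nat_const card_ord muln1.
- by rewrite -(big_mkord xpredT (fun b => nat_of_bool (b < a))) sum_ltn // ltnW.
- rewrite pfunE /ylt -[RHS](@sum_ltn n) ?(ltnW (ltn_ord _)) // big_mkord.
  by rewrite [RHS](reindex_inj (@perm_inj _ p)).
- rewrite /inv_sum big_mkord; apply: eq_bigr => b _.
  by rewrite muln1 !pfunE.
Qed.

(** The points are summed out from the leaves towards a, each giving a factor; for [Cyc] the corners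
    a and c are kept and b, d are summed out. *)
Lemma stat_countE n (p : 'S_n) (st : stat) : stat_count p st = stat_val n (pfun p) st.
Proof.
rewrite /stat_count (sum_ffun4 (fun a b c d => ssat (@xlt n) (ylt p) st a b c d : nat)).
case: st => [||k g|k1 k2 k3].
- rewrite /= /cyc big_mkord; apply: eq_bigr => a _.
  rewrite exchange_big big_mkord; apply: eq_bigr => c _ /=.
  rewrite /below_left !big_mkord big_distrl; apply: eq_bigr => b _.
  rewrite big_distrr; apply: eq_bigr => d _.
  by rewrite !pfunE /= mulnb /xlt /ylt andbACA !andbA.
- rewrite /ssat /stat_val big_mkord.
  under [in RHS]eq_bigr => i _ do rewrite -(kind_valE p Inv i).
  rewrite big_distrl; apply: eq_bigr => a _.
  rewrite big_distrl; apply: eq_bigr => b _.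
  rewrite big_distrr; apply: eq_bigr => c _.
  rewrite big_distrr; apply: eq_bigr => d _.
  by rewrite /= mulnb.
- rewrite /ssat /stat_val big_mkord.
  apply: eq_bigr => a _; rewrite -kind_valE big_distrl; apply: eq_bigr => b _.
  rewrite /inv_sum big_mkord big_distrr; apply: eq_bigr => c _.
  rewrite -kind_valE !big_distrr; apply: eq_bigr => d _.
  by rewrite !pfunE /= !mulnb.
- rewrite /ssat /stat_val big_mkord.
  apply: eq_bigr => a _; rewrite -!kind_valE -mulnA big_distrl; apply: eq_bigr => b _.
  rewrite big_distrl big_distrr; apply: eq_bigr => c _.
  rewrite !big_distrr; apply: eq_bigr => d _.
  by rewrite /= !mulnb.
Qed.

(** * The cyclic statistic by blocks of positions *)

Lemma sum_pick (B x : nat) (F : nat -> nat) :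
  x < B -> \sum_(0 <= c < B) (x == c) * F c = F x.
Proof.
move=> lt_x; rewrite big_mkord (bigD1 (Ordinal lt_x)) //= eqxx mul1n big1 ?addn0 //.
by move=> c; rewrite -val_eqE eq_sym => /negbTE /= ->.
Qed.

Lemma sum_condl a b (P : pred nat) (F : nat -> nat) :
  \sum_(a <= i < b | P i) F i = \sum_(a <= i < b) P i * F i.
Proof. by rewrite big_mkcond; apply: eq_bigr => i _; case: (P i); rewrite ?mul1n. Qed.

(** With bounds turned into indicator factors, nested sums have constant ranges and can be
    exchanged. *)
Lemma sum_range n a b (F : nat -> nat) : b <= n ->
  \sum_(a <= i < b) F i = \sum_(0 <= i < n) ((a <= i) && (i < b)) * F i.
Proof.
move=> le_b; rewrite -sum_condl; case: (leqP a b) => [le_a|lt_b]; last first.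
  rewrite big_geq ?(ltnW lt_b) // big_pred0 // => i; lia.
rewrite (big_cat_nat_idem (addn0 _) (leq0n a) (leq_trans le_a le_b)) //=.
rewrite (big_cat_nat_idem (addn0 _) le_a le_b) //=.
rewrite [X in _ = X + _]big_nat_cond [X in _ = X + _]big_pred0 ?add0n; last by move=> i; lia.
rewrite [X in _ = _ + X]big_nat_cond [X in _ = _ + X]big_pred0 ?addn0; last by move=> i; lia.
rewrite big_nat_cond [RHS]big_nat_cond; apply: eq_bigl => i; lia.
Qed.

Lemma pfun_lt n (p : 'S_n) i : i < n -> pfun p i < n.
Proof. by move=> lt_i; rewrite -[i]/(val (Ordinal lt_i)) pfunE. Qed.

Lemma pfunK n (p : 'S_n) i : i < n -> pfun (p^-1)%g (pfun p i) = i.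
Proof. by move=> lt_i; rewrite -[i]/(val (Ordinal lt_i)) !pfunE permK. Qed.

Lemma pfunKV n (p : 'S_n) i : i < n -> pfun p (pfun (p^-1)%g i) = i.
Proof. by move=> lt_i; rewrite -[i]/(val (Ordinal lt_i)) !pfunE permKV. Qed.

Lemma sum_pfun n (p : 'S_n) (H : nat -> nat) :
  \sum_(0 <= u < n) H u = \sum_(0 <= k < n) H (pfun p k).
Proof.
rewrite !big_mkord (reindex_inj (@perm_inj _ p)); apply: eq_bigr => k _.
by rewrite pfunE.
Qed.

Section Blocks.
Variables (n : nat) (p : 'S_n) (B : nat).
Hypotheses (B_gt0 : 0 < B) (nB : n <= B * B).

Let f := pfun p.
Let q := pfun (p^-1)%g.

(** For a fixed block c, this count and the next depend on a single point, so one pass over the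
    values computes them for all points. *)
Definition left_below (c j : nat) : nat := \sum_(0 <= k < n) ((k %/ B < c) && (f k < f j)).
Definition block_above (c l : nat) : nat := \sum_(0 <= i < n) ((i %/ B == c) && (f l < f i)).

(* Of the quadruples (i, j, k, l) of [cyc], the first inner sum covers those with
   k and i in different blocks, the second those with k and i in one block but l
   and j in different blocks; c is the block of i, respectively of j. *)
Definition far_pairs : nat :=
  \sum_(0 <= c < B) \sum_(0 <= j < n) left_below c j *
    (\sum_(0 <= l < j) block_above c l
     + \sum_(0 <= l < j) (l %/ B == j %/ B) * block_above c l).

Definition block_end (j : nat) : nat := minn n ((j %/ B).+1 * B).

(** The contents of the tree when the sweep reaches the value v. The key f i has been inserted once
    for each k before i in the block of i with f k < v. *)
Definition inserted (v z : nat) : nat :=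
  \sum_(0 <= u < v) \sum_((q u).+1 <= i < block_end (q u)) (f i == z).

(** At the value v the sweep stands at j = q v; each l before j in its block asks for the inserted
    keys f i above f l. The bound is the number N of leaves of the tree, since no key from n on is
    ever inserted. *)
Definition near_pairs (N : nat) : nat :=
  \sum_(0 <= v < n) \sum_(q v %/ B * B <= l < q v) \sum_((f l).+1 <= z < N) inserted v z.

Lemma div_lt i : i < n -> i %/ B < B.
Proof. by move=> lt_i; rewrite ltn_divLR //; apply: leq_trans nB. Qed.

Lemma far_left :
  \sum_(0 <= c < B) \sum_(0 <= j < n) left_below c j * \sum_(0 <= l < j) block_above c l =
  \sum_(0 <= i < n) \sum_(0 <= j < n)
    (\sum_(0 <= k < n) ((k %/ B < i %/ B) && (f k < f j))) * below_left n f j i.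
Proof.
(* The block of i becomes a summation variable c, singled out by an indicator, so that the sum over
   c can be moved outside. *)
transitivity (\sum_(0 <= i < n) \sum_(0 <= c < B) (i %/ B == c) *
   \sum_(0 <= j < n) left_below c j * below_left n f j i); last first.
  apply: eq_big_nat => i /andP [_ lt_i].
  by rewrite (sum_pick (fun c => \sum_(0 <= j < n) left_below c j * _) (div_lt lt_i)).
rewrite [RHS]exchange_big; apply: eq_bigr => c _ /=.
under [RHS]eq_bigr => i _ do rewrite big_distrr /=.
rewrite [RHS]exchange_big; apply: eq_big_nat => j /andP [_ lt_j] /=.
under [RHS]eq_bigr => i _ do rewrite mulnCA.
rewrite -big_distrr /=; congr (_ * _).
rewrite (sum_range _ _ (ltnW lt_j)) /block_above.
under eq_bigr => l _ do rewrite big_distrr /=.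
rewrite exchange_big; apply: eq_bigr => i _ /=.
rewrite big_distrr; apply: eq_bigr => l _ /=.
by rewrite !mulnb; congr nat_of_bool; rewrite andbCA.
Qed.

(** The cycle is symmetric under exchanging (i, k) with (j, l). The variables j and l on the left
    are i and k on the right, and c is now the block of j. *)
Lemma far_right :
  \sum_(0 <= c < B) \sum_(0 <= j < n) left_below c j *
    \sum_(0 <= l < j) (l %/ B == j %/ B) * block_above c l =
  \sum_(0 <= i < n) \sum_(0 <= j < n)
    (\sum_(0 <= k < n) [&& k < i, k %/ B == i %/ B & f k < f j])
    * (\sum_(0 <= l < n) ((l %/ B < j %/ B) && (f l < f i))).
Proof.
rewrite exchange_big; apply: eq_big_nat => i /andP [_ lt_i] /=.
transitivity (\sum_(0 <= j < n) \sum_(0 <= c < B) (j %/ B == c) *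
  ((\sum_(0 <= k < n) [&& k < i, k %/ B == i %/ B & f k < f j]) * left_below c i)); last first.
  apply: eq_big_nat => j /andP [_ lt_j].
  by rewrite (sum_pick (fun c => _ * left_below c i) (div_lt lt_j)).
rewrite [RHS]exchange_big; apply: eq_bigr => c _ /=.
under [RHS]eq_bigr => j _ do rewrite mulnA mulnC.
rewrite -big_distrr /=; congr (_ * _).
rewrite (sum_range _ _ (ltnW lt_i)) /block_above.
under eq_bigr => l _ do rewrite mulnA big_distrr /=.
rewrite exchange_big; apply: eq_bigr => j _ /=.
rewrite big_distrr; apply: eq_bigr => l _ /=.
by rewrite !mulnb; congr nat_of_bool; case: (_ < i); case: (_ == i %/ B); case: (_ == c).
Qed.

(** Substituting v = f j and u = f k turns the order of the sweep into the condition f k < f j, and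
    the loop bounds inside a block into conditions of equal blocks. *)
Lemma nearE N : n <= N -> near_pairs N =
  \sum_(0 <= i < n) \sum_(0 <= j < n)
    (\sum_(0 <= k < n) [&& k < i, k %/ B == i %/ B & f k < f j])
    * (\sum_(0 <= l < n) [&& l < j, l %/ B == j %/ B & f l < f i]).
Proof.
move=> nN; rewrite /near_pairs (sum_pfun p) [RHS]exchange_big /=.
apply: eq_big_nat => j /andP [_ lt_j].
rewrite /q pfunK // (sum_range _ _ (ltnW lt_j)).
transitivity (\sum_(0 <= l < n) ((l < j) && (l %/ B == j %/ B)) *
   \sum_(0 <= i < n) \sum_(0 <= k < n) [&& k < i, k %/ B == i %/ B & f k < f j] * (f l < f i)).
  apply: eq_big_nat => l /andP [_ lt_l]; congr (_ * _).
    congr nat_of_bool; rewrite andbC -leq_divRL //; case: (ltnP l j) => //= lt_lj.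
    by rewrite eqn_leq (leq_div2r _ (ltnW lt_lj)).
  rewrite /inserted.
  transitivity (\sum_(0 <= k < n) (f k < f j) * \sum_(0 <= i < n)
      ((k < i) && (i < block_end k)) * (f l < f i)).
    rewrite exchange_big /=.
    rewrite (@sum_range n) ?(ltnW (pfun_lt _ lt_j)) // (sum_pfun p).
    apply: eq_big_nat => k /andP [_ lt_k]; rewrite -/f /q pfunK //=; congr (_ * _).
    rewrite exchange_big /= (@sum_range n) ?geq_minl //.
    apply: eq_big_nat => i /andP [_ lt_i]; congr (_ * _).
    rewrite (@sum_range N) //.
    have fiN : f i < N by apply: leq_trans nN; apply: pfun_lt.
    rewrite -[RHS](sum_pick (fun z => nat_of_bool (f l < z)) fiN).
    apply: eq_big_nat => z /andP [_ ->]; rewrite andbT mulnC; congr (_ * _).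
  rewrite [RHS]exchange_big; apply: eq_bigr => k _ /=.
  rewrite big_distrr; apply: eq_big_nat => i /andP [_ lt_i] /=.
  rewrite mulnA mulnb; congr (nat_of_bool _ * _).
  rewrite /block_end leq_min lt_i /= -ltn_divLR // ltnS eqn_leq.
  case: (ltnP k i) => [lt_ki|] /=; rewrite ?andbF ?andFb //.
  by rewrite (leq_div2r _ (ltnW lt_ki)) /= andbC.
under eq_bigr => l _ do rewrite big_distrr /=.
rewrite exchange_big; apply: eq_bigr => i _ /=.
rewrite big_distrr; apply: eq_bigr => l _ /=.
rewrite -big_distrl /= mulnCA mulnb; congr (_ * nat_of_bool _).
by rewrite andbA.
Qed.

(* Each of the two comparisons of positions is either between different blocks
   or within one block. *)
Lemma cyc_split N : n <= N -> cyc n f = far_pairs + near_pairs N.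
Proof.
move=> nN; rewrite /far_pairs.
under eq_bigr => c _ do (under eq_bigr => j _ do rewrite mulnDr; rewrite big_split /=).
rewrite big_split /= far_left far_right (nearE nN) -!big_split /=.
apply: eq_bigr => i _; rewrite -!big_split /=; apply: eq_bigr => j _.
have split_lt a b : (a < b) = (a %/ B < b %/ B) || ((a < b) && (a %/ B == b %/ B)).
  case: (ltngtP a b) => [lt|gt|->]; rewrite ?ltnn //=.
    by have := leq_div2r B (ltnW lt); rewrite leq_eqVlt orbC.
  by apply/esym/negbTE; rewrite orbF -leqNgt leq_div2r // ltnW.
have sumE a b : below_left n f a b =
    \sum_(0 <= k < n) ((k %/ B < a %/ B) && (f k < f b)) +
    \sum_(0 <= k < n) [&& k < a, k %/ B == a %/ B & f k < f b].
  rewrite /below_left -big_split /=; apply: eq_bigr => k _.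
  rewrite {1}split_lt.
  by case: (ltngtP (k %/ B)) => //=; rewrite ?andbF ?andbT ?addn0.
by rewrite -addnA -mulnDr -sumE -mulnDl -sumE.
Qed.
End Blocks.

(** * Program logic *)

Notation "c1 ;; c2" := (Seq c1 c2) (at level 60, right associativity).

Definition For (r : nat) (b : expr) (c : cmd) : cmd :=
  While (Bin Lt (Reg r) b) (c ;; Assign r (Bin Add (Reg r) (Const 1))).

(* Kept opaque to [lia], which would split on every remainder in the context. *)
Definition trunc (W v : nat) : nat := v %% W.
Notation "v %! W" := (trunc W v) (at level 40, left associativity).

Lemma trunc_small W v : v < W -> v %! W = v.
Proof. exact: modn_small. Qed.

Lemma trunc0 W : 0 %! W = 0.
Proof. exact: mod0n. Qed.

Section Logic.
Variables (w m W : nat).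
Hypothesis W_def : 2 ^ w = W.

(** Total correctness: termination and staying within the m cells are included, as [exec] has no
    derivation otherwise. *)
Definition run (c : cmd) (s : state) (T : nat) (Q : state -> Prop) : Prop :=
  exists t s', [/\ exec w m c s t s', t <= T & Q s'].

(** Here v is the exact value, which the machine knows only modulo W. Sums and products need no
    bound on it; quotients, comparisons and addresses need v < W. *)
Definition evalm (s : state) (e : expr) (v : nat) : Prop := Defs.eval w m s e = Some (v %! W).

Lemma ev_const s k : evalm s (Const k) k.
Proof. by rewrite /evalm /trunc /= W_def. Qed.

Lemma ev_reg s r v : regs s r = v %! W -> evalm s (Reg r) v.
Proof. by rewrite /evalm /trunc /= => ->. Qed.

Lemma ev_reg_small s r v : regs s r = v -> v < W -> evalm s (Reg r) v.
Proof. by rewrite /evalm /trunc /= => -> /modn_small ->. Qed.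

Lemma ev_add s a b x y : evalm s a x -> evalm s b y -> evalm s (Bin Add a b) (x + y).
Proof. by rewrite /evalm /trunc /= => -> ->; rewrite /binop_sem W_def modnDm. Qed.

Lemma ev_mul s a b x y : evalm s a x -> evalm s b y -> evalm s (Bin Mul a b) (x * y).
Proof. by rewrite /evalm /trunc /= => -> ->; rewrite /binop_sem W_def modnMm. Qed.

(** Writing the minuend as y + z avoids truncated subtraction and any bound on y and z: y plus its
    complement is a multiple of W. *)
Lemma ev_sub s a b y z : evalm s a (y + z) -> evalm s b y -> evalm s (Bin Defs.Sub a b) z.
Proof.
rewrite /evalm /trunc /= => -> ->; rewrite /binop_sem W_def modnDml.
have W_gt0 : 0 < W by rewrite -W_def expn_gt0.
congr Some; rewrite [y + z]addnC -addnA -modnDmr {1}(divn_eq y W).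
have -> : y %/ W * W + y %% W + (W - y %% W) = (y %/ W).+1 * W.
  by rewrite -addnA subnKC 1?ltnW ?ltn_mod // mulSn addnC.
by rewrite modnMl addn0.
Qed.

Lemma ev_div s a b x y :
  evalm s a x -> evalm s b y -> x < W -> y < W -> evalm s (Bin Div a b) (x %/ y).
Proof.
rewrite /evalm /trunc /= => -> -> hx hy.
by rewrite /binop_sem W_def (modn_small hx) (modn_small hy).
Qed.

Lemma ev_mod s a b x y :
  evalm s a x -> evalm s b y -> x < W -> y < W -> evalm s (Bin Mod a b) (x %% y).
Proof.
rewrite /evalm /trunc /= => -> -> hx hy.
by rewrite /binop_sem W_def (modn_small hx) (modn_small hy).
Qed.

Lemma ev_lt s a b x y :
  evalm s a x -> evalm s b y -> x < W -> y < W -> evalm s (Bin Lt a b) (x < y).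
Proof.
rewrite /evalm /trunc /= => -> -> hx hy.
by rewrite /binop_sem W_def (modn_small hx) (modn_small hy).
Qed.

Lemma ev_eq s a b x y :
  evalm s a x -> evalm s b y -> x < W -> y < W -> evalm s (Bin Eq a b) (x == y).
Proof.
rewrite /evalm /trunc /= => -> -> hx hy.
by rewrite /binop_sem W_def (modn_small hx) (modn_small hy).
Qed.

Lemma ev_read s a x v :
  evalm s a x -> x < W -> x < m -> Defs.mem s x = v %! W -> evalm s (Read a) v.
Proof. by rewrite /evalm /trunc /= => -> hx hm; rewrite (modn_small hx) hm => ->. Qed.

Lemma ev_eqv s e v v' : evalm s e v -> v = v' -> evalm s e v'.
Proof. by move=> h <-. Qed.

Lemma run_le c s T T' Q : run c s T Q -> T <= T' -> run c s T' Q.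
Proof. by move=> [t [s' [h le q]]] le'; exists t, s'; split=> //; apply: leq_trans le'. Qed.

Lemma run_imp c s T (Q Q' : state -> Prop) :
  run c s T Q -> (forall s', Q s' -> Q' s') -> run c s T Q'.
Proof. by move=> [t [s' [h le q]]] imp; exists t, s'; split=> //; apply: imp. Qed.

Lemma run_seq c1 c2 s T1 T2 Q :
  run c1 s T1 (fun s1 => run c2 s1 T2 Q) -> run (c1 ;; c2) s (T1 + T2) Q.
Proof.
move=> [t1 [s1 [h1 le1 [t2 [s2 [h2 le2 q]]]]]]; exists (t1 + t2), s2; split=> //.
  exact: ExecSeq h1 h2.
exact: leq_add.
Qed.

Lemma run_assign s r e v (Q : state -> Prop) :
  evalm s e v -> Q (set_reg s r (v %! W)) -> run (Assign r e) s (ecost e).+1 Q.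
Proof. by move=> h q; exists (ecost e).+1, (set_reg s r (v %! W)); split=> //; constructor. Qed.

Lemma run_assign_small s r e v (Q : state -> Prop) :
  evalm s e v -> v < W -> Q (set_reg s r v) -> run (Assign r e) s (ecost e).+1 Q.
Proof. by move=> h hv q; apply: (run_assign h); rewrite trunc_small. Qed.

Lemma run_write s a e x v (Q : state -> Prop) :
  evalm s a x -> x < W -> x < m -> evalm s e v -> Q (set_mem s x (v %! W)) ->
  run (Write a e) s (ecost a + ecost e).+1 Q.
Proof.
move=> h hx hm h' q; exists (ecost a + ecost e).+1, (set_mem s x (v %! W)); split=> //.
by constructor=> //; rewrite -(trunc_small hx).
Qed.

(** The body must preserve the counter and prepare the invariant for the state after the increment,
    which [For] performs. Besides [ecost b] and T a round pays 2 for the comparison, 4 for the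
    increment and 1 for the loop. *)
Lemma run_for (I : nat -> state -> Prop) r b c lo hi T s :
  lo <= hi -> hi < W ->
  (forall j s, lo <= j <= hi -> I j s -> regs s r = j /\ evalm s b hi) ->
  I lo s ->
  (forall j s, lo <= j < hi -> I j s ->
     run c s T (fun s' => regs s' r = j /\ I j.+1 (set_reg s' r j.+1))) ->
  run (For r b c) s ((hi - lo) * (ecost b + T + 7) + ecost b + 3) (I hi).
Proof.
move=> le_lohi hiW condI I0 body.
have W_gt0 : 0 < W by apply: leq_trans hiW.
have cond j s' : lo <= j <= hi -> I j s' ->
    Defs.eval w m s' (Bin Lt (Reg r) b) = Some (j < hi : nat).
  move=> jr Ij; have [ej eb] := condI j s' jr Ij.
  have := ev_lt (ev_reg_small ej _) eb; rewrite /evalm => -> //; try lia.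
  by rewrite trunc_small //; case: ltnP => /=; lia.
have H d : forall j s', hi - j = d -> lo <= j <= hi -> I j s' ->
    run (For r b c) s' (d * (ecost b + T + 7) + ecost b + 3) (I hi).
  elim: d => [|d IH] j s' dE jr Ij.
    have jhi : j = hi by lia.
    exists (ecost (Bin Lt (Reg r) b)).+1, s'; split=> //=; try lia; last by rewrite -jhi.
    by apply: ExecWhileFalse; rewrite (cond j) // jhi ltnn.
  have jlt : j < hi by lia.
  have [|t1 [s1 [h1 le1 [r1 I1]]]] := body j s' _ Ij; first by lia.
  have [||t2 [s2 [h2 le2 I2]]] := IH j.+1 _ _ _ I1; try lia.
  exists (ecost (Bin Lt (Reg r) b) + (t1 + 4) + t2).+1, s2; split=> //; last by rewrite /=; lia.
  apply: (@ExecWhileTrue _ _ _ (set_reg s1 r j.+1) _ _ _ 1) => //; first by rewrite (cond j) ?jlt.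
  apply: ExecSeq h1 _; apply: ExecAssign.
  have := ev_add (ev_reg_small r1 _) (ev_const s1 1); rewrite /evalm => -> //; try lia.
  by rewrite trunc_small addn1 //; lia.
by apply: (H _ lo) => //; rewrite leqnn.
Qed.
End Logic.

Ltac reg_step := rewrite /= ?/upd /=; first [eassumption | reflexivity].
Ltac ev_step H :=
  lazymatch goal with
  | |- evalm _ _ _ _ (Const _) _ => exact: (ev_const _ H)
  | |- evalm _ _ _ _ (Reg _) _ =>
      first [ eapply ev_reg; reg_step | eapply ev_reg_small; [reg_step | try lia] ]
  | |- evalm _ _ _ _ (Bin Add _ _) _ => eapply (ev_add H)
  | |- evalm _ _ _ _ (Bin Mul _ _) _ => eapply (ev_mul H)
  | |- evalm _ _ _ _ (Bin Div _ _) _ => eapply (ev_div H)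
  | |- evalm _ _ _ _ (Bin Mod _ _) _ => eapply (ev_mod H)
  | |- evalm _ _ _ _ (Bin Lt _ _) _ => eapply (ev_lt H)
  | |- evalm _ _ _ _ (Bin Eq _ _) _ => eapply (ev_eq H)
  end.
Ltac ev_solve H := repeat ev_step H; try lia.

(** * A binary tree of partial sums *)

Section Tree.
Variable L : nat.
Local Notation N := (2 ^ L).

(** Heap numbering: the root is 1, the children of u are 2u and 2u + 1, and leaf y is N + y. The sum
    tells whether u > 0 lies on the path from leaf y to the root, in the form in which the update
    loop builds it. *)
Definition anc (u y : nat) : nat := \sum_(0 <= e < L.+1) ((N + y) %/ 2 ^ e == u).

Definition node (a : nat -> nat) (u : nat) : nat := \sum_(0 <= y < N) a y * anc u y.

Lemma anc_leaf y z : y < N -> z < N -> anc (N + z) y = (y == z).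
Proof.
move=> lt_y lt_z; rewrite /anc big_nat_recl // divn1 eqn_add2l big_nat_cond big1 ?addn0 //.
move=> e _; apply/eqP; rewrite eqb0; apply/negP => /eqP h.
have : (N + y) %/ 2 ^ e.+1 <= (N + y) %/ 2.
  by apply: leq_div2l => //; rewrite expnS; have := expn_gt0 2 e; lia.
rewrite h; lia.
Qed.

(** Each ancestor is half of the previous one, so it equals u exactly when the previous one is a
    child of u. The end terms vanish: a leaf is not an inner node, and the root is not a child. *)
Lemma anc_node u y : y < N -> 0 < u < N -> anc u y = anc u.*2 y + anc u.*2.+1 y.
Proof.
move=> lt_y /andP [u_gt0 lt_u]; rewrite /anc -big_split /= big_nat_recl // divn1.
have -> : (N + y == u) = false by lia.
rewrite add0n big_nat_recr //=.
have -> : (N + y) %/ 2 ^ L = 1 by rewrite divnDl ?dvdnn // divnn expn_gt0 divn_small.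
have -> : (1 == u.*2) = false by lia.
have -> : (1 == u.*2.+1) = false by lia.
rewrite !addn0; apply: eq_bigr => e _; rewrite expnSr divnMA.
by move: (_ %/ 2 ^ e) => z; lia.
Qed.

Lemma node_split a u : 0 < u < N -> node a u = node a u.*2 + node a u.*2.+1.
Proof.
move=> hu; rewrite /node -big_split /=; apply: eq_big_nat => y /andP [_ lt_y].
by rewrite -mulnDr anc_node.
Qed.

Lemma node_leaf a z : z < N -> node a (N + z) = a z.
Proof.
move=> lt_z; rewrite -[RHS](sum_pick a lt_z); apply: eq_big_nat => y /andP [_ lt_y].
by rewrite anc_leaf // mulnC eq_sym.
Qed.

Lemma node_add a y v u : y < N ->
  node (fun z => a z + (z == y) * v) u = node a u + v * anc u y.
Proof.
move=> lt_y; rewrite /node; under eq_bigr => z _ do rewrite mulnDl.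
rewrite big_split /=; congr (_ + _).
rewrite -(sum_pick (fun z => v * anc u z) lt_y); apply: eq_bigr => z _.
by rewrite mulnA [z == y]eq_sym.
Qed.

Lemma sum_double (F : nat -> nat) a b : a <= b ->
  \sum_(a <= u < b) (F u.*2 + F u.*2.+1) = \sum_(a.*2 <= u < b.*2) F u.
Proof.
move=> /subnKC <-; elim: (b - a) => [|d IH]; first by rewrite addn0 !big_geq.
rewrite addnS big_nat_recr ?leq_addr //= IH doubleS.
by rewrite !big_nat_recr ?leq_double ?leq_addr //= -?addnA // leqW ?leq_double ?leq_addr.
Qed.

Definition path_sum (a : nat -> nat) (y e : nat) : nat :=
  \sum_(0 <= d < e) ((N + y) %/ 2 ^ d %% 2 == 0) * node a ((N + y) %/ 2 ^ d %/ 2 * 2 + 1).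

(* The nodes at height d to the right of the ancestor of y, together with the
   right siblings met below height d, cover exactly the leaves right of y. *)
Lemma path_sumE a y : y < N -> path_sum a y L.+1 = \sum_(y.+1 <= z < N) a z.
Proof.
move=> lt_y.
have anc_range e : e <= L -> 2 ^ (L - e) <= (N + y) %/ 2 ^ e < 2 ^ (L - e).+1.
  move=> le_e; have h : 2 ^ (L - e) * 2 ^ e = N by rewrite -expnD subnK.
  rewrite leq_divRL ?expn_gt0 // ltn_divLR ?expn_gt0 // expnS -mulnA h; lia.
have H e : e <= L -> path_sum a y e +
    \sum_(((N + y) %/ 2 ^ e).+1 <= u < 2 ^ (L - e).+1) node a u = \sum_(y.+1 <= z < N) a z.
  elim: e => [|e IH] le_e.
    rewrite /path_sum big_geq // add0n divn1 subn0 -addnS.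
    rewrite -{1}[(N + y.+1)]addnC big_addn expnS mul2n -addnn addnK.
    by apply: eq_big_nat => z /andP [_ lt_z]; rewrite addnC node_leaf.
  rewrite -(IH (ltnW le_e)) /path_sum big_nat_recr //= -addnA; congr (_ + _).
  have := anc_range _ (ltnW le_e); rewrite [2 ^ e.+1]expnSr divnMA.
  have -> : (L - e).+1 = (L - e.+1).+2 by lia.
  have -> : L - e = (L - e.+1).+1 by lia.
  have : 2 ^ (L - e.+1).+1 <= N by rewrite leq_exp2l //; lia.
  set i := (N + y) %/ 2 ^ e; set k := L - e.+1 => leN.
  rewrite [2 ^ k.+2]expnS => /andP [lo hi].
  rewrite (eq_big_nat _ _ (F2 := fun u => node a u.*2 + node a u.*2.+1)); last first.
    by move=> u ur; apply: node_split; lia.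
  rewrite sum_double; last by lia.
  rewrite -[(2 ^ k.+1).*2]mul2n.
  (* An even i is a left child and its right sibling i + 1 joins the path sum; after an odd i the
     nodes to the right already pair up into siblings. *)
  case: eqP => [even|odd].
    rewrite mul1n [in RHS]big_ltn; last by lia.
    have -> : i %/ 2 * 2 + 1 = i.+1 by lia.
    by have -> : (i %/ 2).+1.*2 = i.+2 by lia.
  by rewrite mul0n; have -> : (i %/ 2).+1.*2 = i.+1 by lia.
(* At height L the ancestor is the root, node 1: it is odd, so it adds no sibling, and nothing lies
   to its right. *)
rewrite /path_sum big_nat_recr //=.
have := H L (leqnn _); rewrite subnn.
have -> : (N + y) %/ 2 ^ L = 1 by rewrite divnDl ?dvdnn // divnn expn_gt0 divn_small.
by rewrite big_geq // => <-.
Qed.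
End Tree.

(** * The program *)

(* Array k consists of 2N cells from k * 2N on, where N = 2 ^ L >= n: arrays 0 and
   1 hold the permutation and its inverse, 2 to 5 the sums over inversions of 1,
   of the position, of the value and of array 2, 6 and 7 ranks with respect to
   the current block, and 8 a binary tree of partial sums rooted at cell 1.
   Registers 0 to 4 hold n, N, L + 1, 2N and the block length; the tree
   operations take a key in 40 and a weight in 41, and answer in 44. *)
Definition arr (k : nat) (e : expr) : expr := Bin Add (Bin Mul (Const k) (Reg 3)) e.

Definition update : cmd :=
  Assign 42 (Bin Add (Reg 1) (Reg 40)) ;;
  Assign 43 (Const 0) ;;
  For 43 (Reg 2)
    (Write (arr 8 (Reg 42)) (Bin Add (Read (arr 8 (Reg 42))) (Reg 41)) ;;
     Assign 42 (Bin Div (Reg 42) (Const 2))).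

(** The sibling is read in every round and masked by the parity test. For an odd node the address is
    the node itself, so the access always stays in the tree. *)
Definition query : cmd :=
  Assign 44 (Const 0) ;;
  Assign 42 (Bin Add (Reg 1) (Reg 40)) ;;
  Assign 43 (Const 0) ;;
  For 43 (Reg 2)
    (Assign 44 (Bin Add (Reg 44) (Bin Mul (Bin Eq (Bin Mod (Reg 42) (Const 2)) (Const 0))
       (Read (arr 8 (Bin Add (Bin Mul (Bin Div (Reg 42) (Const 2)) (Const 2)) (Const 1)))))) ;;
     Assign 42 (Bin Div (Reg 42) (Const 2))).

Definition clear_tree : cmd :=
  Assign 20 (Const 0) ;;
  For 20 (Reg 3) (Write (arr 8 (Reg 20)) (Const 0)).

(** Positions are visited from left to right and the query precedes the insertion. So the tree holds
    the points to the left, and those with larger keys are the inversions ending here. *)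
Definition sweep (k : nat) (e : expr) : cmd :=
  clear_tree ;;
  Assign 20 (Const 0) ;;
  For 20 (Reg 0)
    (Assign 40 (Read (arr 0 (Reg 20))) ;;
     query ;;
     Write (arr k (Reg 20)) (Reg 44) ;;
     Assign 41 e ;;
     update).

(** Points are visited by increasing value. Array 6 is written before its counter moves and counts
    strictly lower points; array 7 is written after, so that the block total minus its entry counts
    strictly higher ones. *)
Definition far_ranks : cmd :=
  Assign 22 (Const 0) ;;
  Assign 24 (Const 0) ;;
  Assign 26 (Const 0) ;;
  For 26 (Reg 0)
    (Assign 25 (Read (arr 1 (Reg 26))) ;;
     Write (arr 6 (Reg 25)) (Reg 24) ;;
     Assign 24 (Bin Add (Reg 24) (Bin Lt (Bin Div (Reg 25) (Reg 4)) (Reg 21))) ;;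
     Assign 22 (Bin Add (Reg 22) (Bin Eq (Bin Div (Reg 25) (Reg 4)) (Reg 21))) ;;
     Write (arr 7 (Reg 25)) (Reg 22)).

(* Register 27 sums over all earlier positions, register 28 only over those in
   the block of the current one. *)
Definition far_sum : cmd :=
  Assign 27 (Const 0) ;;
  Assign 28 (Const 0) ;;
  Assign 26 (Const 0) ;;
  For 26 (Reg 0)
    (Assign 30 (Bin Add (Reg 30)
       (Bin Mul (Read (arr 6 (Reg 26))) (Bin Add (Reg 27) (Reg 28)))) ;;
     Assign 29 (Bin Defs.Sub (Reg 22) (Read (arr 7 (Reg 26)))) ;;
     Assign 27 (Bin Add (Reg 27) (Reg 29)) ;;
     Assign 28 (Bin Mul (Bin Add (Reg 28) (Reg 29))
       (Bin Eq (Bin Div (Bin Add (Reg 26) (Const 1)) (Reg 4))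
          (Bin Div (Reg 26) (Reg 4))))).

Definition far : cmd :=
  Assign 30 (Const 0) ;;
  Assign 21 (Const 0) ;;
  For 21 (Reg 4) (far_ranks ;; far_sum).

Definition near_queries : cmd :=
  Assign 23 (Bin Mul (Bin Div (Reg 22) (Reg 4)) (Reg 4)) ;;
  For 23 (Reg 22)
    (Assign 40 (Read (arr 0 (Reg 23))) ;;
     query ;;
     Assign 30 (Bin Add (Reg 30) (Reg 44))).

(** Register 25 receives, without a branch, the minimum of n and the start of the next block. *)
Definition near_insertions : cmd :=
  Assign 24 (Bin Mul (Bin Add (Bin Div (Reg 22) (Reg 4)) (Const 1)) (Reg 4)) ;;
  Assign 25 (Bin Add (Bin Mul (Bin Lt (Reg 0) (Reg 24)) (Reg 0))
    (Bin Mul (Bin Lt (Reg 24) (Bin Add (Reg 0) (Const 1))) (Reg 24))) ;;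
  Assign 41 (Const 1) ;;
  Assign 26 (Bin Add (Reg 22) (Const 1)) ;;
  For 26 (Reg 25)
    (Assign 40 (Read (arr 0 (Reg 26))) ;;
     update).

Definition near : cmd :=
  clear_tree ;;
  Assign 30 (Const 0) ;;
  Assign 21 (Const 0) ;;
  For 21 (Reg 0)
    (Assign 22 (Read (arr 1 (Reg 21))) ;;
     near_queries ;;
     near_insertions).

Definition invert : cmd :=
  Assign 20 (Const 0) ;;
  For 20 (Reg 0) (Write (arr 1 (Read (arr 0 (Reg 20)))) (Reg 20)).

Definition kind_expr (k : kind) : expr :=
  match k with
  | One => Const 1
  | Tot => Reg 0
  | Pos => Reg 20
  | Val => Read (arr 0 (Reg 20))
  | Inv => Read (arr 2 (Reg 20))
  end.

Definition inv_expr (g : kind) : expr :=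
  match g with
  | One => Read (arr 2 (Reg 20))
  | Tot => Bin Mul (Reg 0) (Read (arr 2 (Reg 20)))
  | Pos => Read (arr 3 (Reg 20))
  | Val => Read (arr 4 (Reg 20))
  | Inv => Read (arr 5 (Reg 20))
  end.

Definition point_expr (st : stat) : expr :=
  match st with
  | Path k g => Bin Mul (kind_expr k) (inv_expr g)
  | Star k1 k2 k3 => Bin Mul (Bin Mul (kind_expr k1) (kind_expr k2)) (kind_expr k3)
  | _ => Const 0
  end.

Definition closed_expr (st : stat) : expr :=
  match st with
  | Cyc => Bin Add (Reg 5) (Reg 6)
  | Sq => Bin Mul (Reg 9) (Reg 9)
  | _ => Const 0
  end.

(** The combination is unrolled into one expression, so its cost depends on the pattern but not on
    n. *)
Definition lin_expr (X : stat -> expr) (cs : seq nat) : expr :=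
  foldr (fun x e => Bin Add (Bin Mul (Const x.1) (X x.2)) e) (Const 0) (zip cs stats).

Definition totals (pos neg : seq nat) : cmd :=
  Assign 7 (Const 0) ;;
  Assign 8 (Const 0) ;;
  Assign 9 (Const 0) ;;
  Assign 20 (Const 0) ;;
  For 20 (Reg 0)
    (Assign 7 (Bin Add (Reg 7) (lin_expr point_expr pos)) ;;
     Assign 8 (Bin Add (Reg 8) (lin_expr point_expr neg)) ;;
     Assign 9 (Bin Add (Reg 9) (Read (arr 2 (Reg 20))))) ;;
  Assign 7 (Bin Add (Reg 7) (lin_expr closed_expr pos)) ;;
  Assign 8 (Bin Add (Reg 8) (lin_expr closed_expr neg)) ;;
  Assign 0 (Bin Div (Bin Defs.Sub (Reg 7) (Reg 8)) (Const 12)).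

Definition arrays : cmd :=
  sweep 2 (kind_expr One) ;;
  sweep 3 (kind_expr Pos) ;;
  sweep 4 (kind_expr Val) ;;
  sweep 5 (kind_expr Inv) ;;
  far ;;
  Assign 5 (Reg 30) ;;
  near ;;
  Assign 6 (Reg 30).

(** * Correctness and cost of the routines *)

Section Routines.
Variables (w m W : nat).
Hypothesis W_def : 2 ^ w = W.
Variables (n : nat) (p : 'S_n) (L B : nat).
Local Notation N := (2 ^ L).
Local Notation M := (2 * N).
Hypotheses (nN : n <= N) (mM : 9 * M <= m) (WM : 9 * M < W).
Hypotheses (B_gt0 : 0 < B) (nB : n <= B * B) (Bn : B <= n.+1).
Local Notation f := (pfun p).
Local Notation q := (pfun (p^-1)%g).
Local Notation run := (run w m).
Local Notation ev := (evalm w m W).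
Local Notation assign_small := (@run_assign_small w m W _ _ _ _ _).
Local Notation assign_mod := (@run_assign w m W _ _ _ _ _).

Definition cell (s : state) (k i : nat) : nat := Defs.mem s (k * M + i).

Definition set_cell (s : state) (k i v : nat) : state := set_mem s (k * M + i) v.

(** Registers and arrays are numbered so that what a routine must preserve lies below two
    thresholds; results kept higher up, as in register 30, are tracked separately. *)
Definition frame (b a : nat) (s s' : state) : Prop :=
  (forall r, r < b -> regs s' r = regs s r) /\
  (forall k i, k < a -> i < M -> cell s' k i = cell s k i).

Record env (s : state) : Prop := Env {
  env_n : regs s 0 = n;
  env_N : regs s 1 = N;
  env_L : regs s 2 = L.+1;
  env_M : regs s 3 = M;
  env_B : regs s 4 = B;
  env_f : forall i, i < n -> cell s 0 i = f i;
  env_q : forall i, i < n -> cell s 1 i = q i }.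

Lemma N_gt0 : 0 < N. Proof. by rewrite expn_gt0. Qed.
Lemma L_lt : L < N. Proof. exact: ltn_expl. Qed.

Lemma frame_refl b a s : frame b a s s. Proof. by []. Qed.

Lemma frame_trans b a s1 s2 s3 : frame b a s1 s2 -> frame b a s2 s3 -> frame b a s1 s3.
Proof.
move=> [r1 c1] [r2 c2]; split=> [r hr|k i hk hi]; first by rewrite r2 // r1.
by rewrite c2 // c1.
Qed.

Lemma frame_weak b a b' a' s1 s2 : frame b' a' s1 s2 -> b <= b' -> a <= a' -> frame b a s1 s2.
Proof.
move=> [r1 c1] hb ha; split=> [r hr|k i hk hi]; first by rewrite r1 //; apply: leq_trans hb.
by rewrite c1 //; apply: leq_trans ha.
Qed.

Lemma frame_set_reg b a s s' r v : b <= r -> frame b a s s' -> frame b a s (set_reg s' r v).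
Proof.
move=> hr [r1 c1]; split=> [r' hr'|k i hk hi]; last exact: c1.
by rewrite /= /upd ltn_eqF ?r1 //; apply: leq_trans hr.
Qed.

Lemma cell_set_cell s k i v k' i' : i < M -> i' < M ->
  cell (set_cell s k i v) k' i' = if (k' == k) && (i' == i) then v else cell s k' i'.
Proof.
move=> hi hi'; rewrite /cell /set_cell /= /upd.
suff -> : (k' * M + i' == k * M + i) = (k' == k) && (i' == i) by [].
apply/eqP/andP => [h|[/eqP -> /eqP ->]] //.
have := congr1 (modn^~ M) h; rewrite !modnMDl !modn_small // => ei.
have := congr1 (divn^~ M) h; rewrite !divnMDl ?muln_gt0 ?N_gt0 // !divn_small // !addn0 => ->.
by rewrite ei.
Qed.

Lemma cell_set_reg s r v k i : cell (set_reg s r v) k i = cell s k i.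
Proof. by []. Qed.

Lemma frame_set_cell b a s s' k i v :
  a <= k -> i < M -> frame b a s s' -> frame b a s (set_cell s' k i v).
Proof.
move=> hk hi [r1 c1]; split=> [r' hr'|k' i' hk' hi']; first exact: r1.
by rewrite cell_set_cell // ltn_eqF ?c1 //; apply: leq_trans hk.
Qed.

Lemma env_frame b a s s' : frame b a s s' -> 5 <= b -> 2 <= a -> env s -> env s'.
Proof.
move=> [r1 c1] hb ha [*]; split; try by rewrite r1 //; lia.
  by move=> i hi; rewrite c1 //; first (by auto); have := N_gt0; lia.
by move=> i hi; rewrite c1 //; first (by auto); have := N_gt0; lia.
Qed.

Lemma ev_cell s k e i v :
  regs s 3 = M -> ev s e i -> i < M -> k < 9 -> cell s k i = v %! W -> ev s (Read (arr k e)) v.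
Proof.
move=> E he hi hk hc; apply: (@ev_read _ _ _ _ _ (k * M + i)) => //; try nia.
apply: (ev_add W_def) => //; apply: (ev_mul W_def); first exact: ev_const.
by apply: ev_reg_small E _; lia.
Qed.

Lemma run_store s k e i x v (Q : state -> Prop) :
  regs s 3 = M -> ev s e i -> ev s x v -> i < M -> k < 9 -> Q (set_cell s k i (v %! W)) ->
  run (Write (arr k e) x) s (ecost e + ecost x + 5) Q.
Proof.
move=> E he hx hi hk hQ.
apply: (@run_le _ _ _ _ ((ecost (arr k e) + ecost x).+1)); last by rewrite /=; lia.
apply: (@run_write _ _ W _ _ _ (k * M + i) v) => //; try nia.
apply: (ev_add W_def) => //; apply: (ev_mul W_def); first exact: ev_const.
by apply: ev_reg_small E _; lia.
Qed.

Ltac evs := ev_solve W_def.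
Ltac frames := repeat first
  [ assumption | exact: frame_refl | apply: frame_set_reg; [done |]
  | apply: frame_set_cell; [lia | lia |] ].

Definition tree (a : nat -> nat) (s : state) : Prop :=
  forall u, 0 < u < M -> cell s 8 u = node L a u %! W.

Lemma tree_frame b a s s' : frame b 9 s s' -> tree a s -> tree a s'.
Proof. by move=> [_ c1] t u hu; rewrite c1 ?t //; lia. Qed.

Definition t_tree := L.+1 * 50 + 30.

Lemma path_range y e : y < N -> e <= L -> 0 < (N + y) %/ 2 ^ e < M.
Proof.
move=> hy he; apply/andP; split.
  by rewrite divn_gt0 ?expn_gt0 //; apply: leq_trans (leq_addr _ _); rewrite leq_exp2l.
by apply: leq_ltn_trans (leq_div _ _) _; lia.
Qed.

Lemma run_update s a y v :
  env s -> regs s 40 = y -> y < N -> regs s 41 = v %! W -> tree a s ->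
  run update s t_tree (fun s' => frame 42 8 s s' /\ tree (fun z => a z + (z == y) * v) s').
Proof.
move=> E ry hy rv t; have [*] := E; have N0 := N_gt0; have LN := L_lt.
(* After e rounds the ancestors of y below height e have received v; for e = L + 1 the partial sum
   is [anc]. *)
pose I e s' := [/\ frame 42 8 s s', regs s' 42 = (N + y) %/ 2 ^ e, regs s' 43 = e &
  forall u, 0 < u < M -> cell s' 8 u =
    (node L a u + v * \sum_(0 <= d < e) ((N + y) %/ 2 ^ d == u)) %! W].
apply: run_le; [apply: run_seq; eapply assign_small; [by evs | lia |] | ].
  apply: run_seq; eapply assign_small; [by evs | lia |].
  apply: run_imp.
    apply: (run_for (W := W) W_def (I := I) (lo := 0) (hi := L.+1) (T := 24)) => //; try lia.
    - move=> j s' _ [F _ rj _]; split=> //; have [*] := env_frame F isT isT E; by evs.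
    - split; rewrite /= ?divn1 //; first by do 2 apply: frame_set_reg => //.
      by move=> u hu; rewrite big_geq // muln0 addn0 -t.
    move=> e s' /andP [_ he] [F r42 r43 C].
    have E' := env_frame F isT isT E; have [*] := E'.
    have hr := path_range hy he.
    have r41 : regs s' 41 = v %! W by rewrite F.1.
    apply: run_le; [apply: run_seq; eapply (run_store (i := (N + y) %/ 2 ^ e)) => // | ].
    + by evs.
    + eapply (ev_add W_def); last by evs.
      by apply: (ev_cell (i := (N + y) %/ 2 ^ e)) => //; [evs; lia | lia | exact: C].
    + by lia.
    + eapply assign_small; [by evs | | ].
        by apply: leq_ltn_trans (leq_div _ _) _; lia.
      rewrite /= ?/upd /=; split=> //; split=> //.
      * by do 2 apply: frame_set_reg => //; apply: frame_set_cell => //; lia.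
      * by rewrite /= /upd /= expnSr divnMA.
      move=> u hu; rewrite -[LHS]/(cell (set_cell _ _ _ _) _ _) cell_set_cell //; try lia.
      rewrite /= big_nat_recr //= mulnDr addnA; case: eqP => [->|ne].
        by rewrite eqxx muln1.
      by rewrite eq_sym; move/eqP/negbTE: ne => ->; rewrite muln0 addn0 C.
    by rewrite /=.
  move=> s' [F _ _ C]; split=> // u hu; rewrite C // node_add //.
by rewrite /= /t_tree; lia.
Qed.

Lemma run_query s a y :
  env s -> regs s 40 = y -> y < N -> tree a s ->
  run query s t_tree (fun s' => frame 42 9 s s' /\
    regs s' 44 = (\sum_(y.+1 <= z < N) a z) %! W).
Proof.
move=> E ry hy t; have [*] := E; have N0 := N_gt0; have LN := L_lt.
pose I e s' := [/\ frame 42 9 s s', regs s' 42 = (N + y) %/ 2 ^ e, regs s' 43 = e &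
  regs s' 44 = path_sum L a y e %! W].
apply: run_le; [apply: run_seq; eapply assign_small; [by evs | lia |] | ].
  apply: run_seq; eapply assign_small; [by evs | lia |].
  apply: run_seq; eapply assign_small; [by evs | lia |].
  apply: run_imp.
    apply: (run_for (W := W) W_def (I := I) (lo := 0) (hi := L.+1) (T := 30)) => //; try lia.
    - move=> j s' _ [F _ rj _]; split=> //; have [*] := env_frame F isT isT E; by evs.
    - split; rewrite /= ?divn1 //; first by do 3 apply: frame_set_reg => //.
      by rewrite /path_sum /= /upd /= big_geq // trunc0.
    move=> e s' /andP [_ he] [F r42 r43 r44].
    have E' := env_frame F isT isT E; have [*] := E'.
    have hr := path_range hy he.
    apply: run_le; [apply: run_seq; eapply assign_mod | ].
    + eapply (ev_add W_def); first by evs.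
      eapply (ev_mul W_def); first by evs.
      apply: (ev_cell (i := (N + y) %/ 2 ^ e %/ 2 * 2 + 1)
        (v := node L a ((N + y) %/ 2 ^ e %/ 2 * 2 + 1))) => //; [by evs | lia | ].
      by rewrite F.2 // ?t //; lia.
    + eapply assign_small; [by evs | | ].
        by apply: leq_ltn_trans (leq_div _ _) _; lia.
      rewrite /= ?/upd /=; split=> //; split=> //.
      * by do 3 apply: frame_set_reg => //.
      * by rewrite /= /upd /= expnSr divnMA.
      by rewrite /= /upd /= /path_sum big_nat_recr.
    by rewrite /=.
  by move=> s' [F _ _ C]; split=> //; rewrite C path_sumE.
by rewrite /= /t_tree; lia.
Qed.

Definition t_clear := M * 20 + 30.

Lemma run_clear s : env s ->
  run clear_tree s t_clear (fun s' => frame 20 8 s s' /\ tree (fun=> 0) s').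
Proof.
move=> E; have [*] := E; have N0 := N_gt0.
pose I j s' := [/\ frame 20 8 s s', regs s' 20 = j &
  forall u, u < j -> cell s' 8 u = 0].
apply: run_le; [apply: run_seq; eapply assign_small; [by evs | lia |] | ].
  apply: run_imp.
    apply: (run_for (W := W) W_def (I := I) (lo := 0) (hi := M) (T := 7)) => //; try lia.
    - move=> j s' _ [F rj _]; split=> //; have [*] := env_frame F isT isT E; by evs.
    - by split=> //; apply: frame_set_reg.
    move=> j s' /andP [_ hj] [F r20 C]; have [*] := env_frame F isT isT E.
    apply: run_le; [eapply (run_store (i := j) (v := 0)) => //; [by evs | by evs |] | by []].
    rewrite /= ?/upd /=; split=> //; split=> //.
      by apply: frame_set_reg => //; apply: frame_set_cell.
    move=> u hu; rewrite -[LHS]/(cell (set_cell _ _ _ _) _ _) cell_set_cell //; try lia.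
    by rewrite trunc0 eqxx /=; case: eqP => // ne; apply: C; lia.
  move=> s' [F _ C]; split=> // u /andP [_ hu].
  by rewrite C // /node big1 ?trunc0.
by rewrite /= /t_clear; lia.
Qed.

Lemma sum_eq_range x a c : x < N -> \sum_(a <= z < N) (z == x) * c = (a <= x) * c.
Proof.
move=> hx; rewrite (@sum_range N) // -[RHS](sum_pick (fun z => (a <= z) * c) hx).
by apply: eq_big_nat => z /andP [_ ->]; rewrite andbT mulnCA [z == x]eq_sym.
Qed.

Lemma f_lt i : i < n -> f i < n. Proof. exact: pfun_lt. Qed.
Lemma q_lt i : i < n -> q i < n. Proof. exact: pfun_lt. Qed.

Definition t_sweep e := t_clear + n * (2 * t_tree + ecost e + 50) + 30.

(** The weight e may read register 20 and the arrays below k, so it is required to evaluate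
    correctly in every state that agrees with s below these thresholds. *)
Lemma run_sweep s k e g :
  env s -> 2 <= k < 8 ->
  (forall s' i, i < n -> frame 20 k s s' -> regs s' 20 = i -> ev s' e (g i)) ->
  run (sweep k e) s (t_sweep e) (fun s' => frame 20 k s s' /\
    forall i, i < n -> cell s' k i = inv_sum n f g i %! W).
Proof.
move=> E hk he; have [*] := E; have N0 := N_gt0.
pose I j s' := [/\ frame 20 k s s', regs s' 20 = j,
  tree (fun z => \sum_(0 <= i < j) (z == f i) * g i) s' &
  forall i, i < j -> cell s' k i = inv_sum n f g i %! W].
apply: run_le; [apply: run_seq; apply: run_imp; first exact: run_clear | ].
  move=> s1 [F1 t1].
  have {}F1 : frame 20 k s s1 by apply: frame_weak F1 _ _; lia.
  apply: run_seq; eapply assign_small; [by evs | lia |].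
  apply: run_imp.
    apply: (run_for (W := W) W_def (I := I) (lo := 0) (hi := n)
      (T := 2 * t_tree + ecost e + 30)) => //; try lia.
    - move=> j s' _ [F rj _ _]; split=> //.
      have [*] := env_frame F isT (ltac:(lia)) E; by evs.
    - split=> //; first by apply: frame_set_reg.
      move=> u hu; rewrite -[LHS]/(cell s1 8 u) t1 //; congr (_ %! _).
      by apply: eq_bigr => y _; rewrite big_geq.
    move=> j s2 /andP [_ hj] [F r20 t C].
    have E' := env_frame F isT (ltac:(lia)) E; have [*] := E'.
    have fj := f_lt hj.
    apply: run_le; [apply: run_seq; eapply assign_small; [| |] | ].
    + apply: (ev_cell (i := j) (v := f j)) => //; [by evs | lia | ].
      by rewrite trunc_small; [auto | lia].
    + by lia.
    + apply: run_seq; apply: run_imp.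
        apply: (@run_query _ (fun z => \sum_(0 <= i < j) (z == f i) * g i) (f j)) => //.
        by lia.
      move=> s3 [F3 r44].
      have {}F3 : frame 42 9 (set_reg s2 40 (f j)) s3 := F3.
      have F3' : frame 40 9 s2 s3.
        apply: (@frame_trans _ _ _ (set_reg s2 40 (f j))); last by apply: frame_weak F3 _ _.
        by apply: frame_set_reg => //; apply: frame_refl.
      have E3 := env_frame F3' isT isT E'; have [*] := E3.
      have r40 : regs s3 40 = f j by rewrite F3.1.
      have r20' : regs s3 20 = j by rewrite F3'.1.
      have t3 := tree_frame F3' t.
      apply: run_seq; eapply (run_store (i := j)) => //; [by evs | by evs | lia | lia |].
      have Fs4 : frame 20 k s (set_cell s3 k j
          ((\sum_((f j).+1 <= z < N) \sum_(0 <= i < j) (z == f i) * g i) %! W)).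
        apply: frame_set_cell; try lia.
        by apply: frame_trans F (frame_weak F3' _ _); lia.
      set s4 := set_cell _ _ _ _ in Fs4 *.
      apply: run_seq; eapply assign_mod; first by apply: (he s4 j).
      apply: run_imp.
        apply: (@run_update _ (fun z => \sum_(0 <= i < j) (z == f i) * g i) (f j) (g j)) => //.
      * by apply: (env_frame (b := 20) (a := k) _ isT _ E); [apply: frame_set_reg Fs4 | lia].
      * by lia.
      * move=> u hu; rewrite -[LHS]/(cell s4 8 u) cell_set_cell //; try lia.
        have -> : (8 == k) = false by lia.
        exact: t3.
      move=> s5 [F5 t5]; have {}F5 : frame 42 8 (set_reg s4 41 (g j %! W)) s5 := F5.
      split; first by rewrite F5.1.
      have cs4 : frame 20 8 s4 s5.
        apply: (@frame_trans _ _ _ (set_reg s4 41 (g j %! W))); last by apply: frame_weak F5 _ _.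
        by apply: frame_set_reg => //; apply: frame_refl.
      split=> //.
      * apply: frame_set_reg => //; apply: frame_trans Fs4 _.
        by apply: frame_weak cs4 _ _; lia.
      * move=> u hu; rewrite -[LHS]/(cell s5 8 u) t5 //; congr (_ %! _).
        by apply: eq_bigr => y _; rewrite big_nat_recr.
      move=> i hi; rewrite -[LHS]/(cell s5 k i) cs4.2 //; try lia.
      rewrite cell_set_cell //; try lia.
      rewrite eqxx /=; case: eqP => [->|ne]; last first.
        by rewrite F3'.2 //; try lia; apply: C; lia.
      congr (_ %! _); rewrite exchange_big /= /inv_sum (sum_range _ _ (ltnW hj)).
      apply: eq_big_nat => l /andP [_ hl]; rewrite sum_eq_range; last by have := f_lt hl; lia.
      by rewrite /= mulnA mulnb.
    by rewrite /=; lia.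
  by move=> s' [F _ _ C].
by rewrite /= /t_sweep; lia.
Qed.

Lemma left_belowE c j : j < n ->
  left_below p B c j = \sum_(0 <= u < f j) (q u %/ B < c).
Proof.
move=> hj; rewrite (sum_range _ _ (ltnW (f_lt hj))) (sum_pfun p) /left_below.
apply: eq_big_nat => k /andP [_ hk]; rewrite pfunK // mulnb /= andbC.
by [].
Qed.

(** The block is split at the value f j. The sum form is what [ev_sub] needs to obtain [block_above]
    from the two ranks. *)
Lemma block_total c j : j < n -> \sum_(0 <= u < n) (q u %/ B == c) =
  \sum_(0 <= u < (f j).+1) (q u %/ B == c) + block_above p B c j.
Proof.
move=> hj; rewrite (big_cat_nat (leq0n _) (f_lt hj)) /=; congr (_ + _).
rewrite (sum_range _ _ (leqnn n)) (sum_pfun p) /block_above.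
by apply: eq_big_nat => k /andP [_ hk]; rewrite pfunK // mulnb f_lt // andbT andbC.
Qed.

Definition t_far := B * (n * 150 + 100) + 30.

Lemma run_far_ranks s c : env s -> regs s 21 = c -> c < B ->
  run far_ranks s (n * 60 + 30)
  (fun s' => [/\ frame 22 6 s s', regs s' 30 = regs s 30,
    regs s' 22 = (\sum_(0 <= u < n) (q u %/ B == c)) %! W &
    forall j, j < n -> cell s' 6 j = left_below p B c j %! W /\
      cell s' 7 j = (\sum_(0 <= u < (f j).+1) (q u %/ B == c)) %! W]).
Proof.
move=> E rc hc; have [*] := E; have N0 := N_gt0.
pose I v s' := [/\ frame 22 6 s s', regs s' 30 = regs s 30 /\ regs s' 26 = v,
  regs s' 22 = (\sum_(0 <= u < v) (q u %/ B == c)) %! W,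
  regs s' 24 = (\sum_(0 <= u < v) (q u %/ B < c)) %! W &
  forall u, u < v -> cell s' 6 (q u) = (\sum_(0 <= u' < u) (q u' %/ B < c)) %! W /\
    cell s' 7 (q u) = (\sum_(0 <= u' < u.+1) (q u' %/ B == c)) %! W].
apply: run_le; [apply: run_seq; eapply assign_small; [by evs | lia |] | ].
  apply: run_seq; eapply assign_small; [by evs | lia |].
  apply: run_seq; eapply assign_small; [by evs | lia |].
  apply: run_imp.
    apply: (run_for (W := W) W_def (I := I) (lo := 0) (hi := n) (T := 50)) => //; try lia.
    - move=> j s' _ [F [_ rj] _ _ _]; split=> //; have [*] := env_frame F isT isT E; by evs.
    - by split=> //; rewrite /= ?/upd /= ?big_geq ?trunc0 //; do 3 apply: frame_set_reg => //.
    move=> v s1 /andP [_ hv] [F [r30 r26] r22 r24 C].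
    have E1 := env_frame F isT isT E; have [*] := E1.
    have qv := q_lt hv; have r21 : regs s1 21 = c by rewrite F.1.
    have qB : q v %/ B <= q v by apply: leq_div.
    apply: run_le; [apply: run_seq; eapply (@run_assign_small w m W _ _ _ (q v)); [| |] | ].
    + by apply: (ev_cell (i := v)) => //; [by evs | lia | rewrite trunc_small; [auto | lia]].
    + by lia.
    + apply: run_seq; eapply (run_store (i := q v)); [done | by evs | by evs | lia | done | ].
      apply: run_seq; eapply assign_mod; first by evs.
      apply: run_seq; eapply assign_mod; first by evs.
      eapply (run_store (i := q v)); [done | by evs | by evs | lia | done | ].
      split=> //; split=> //; try by rewrite /= ?/upd /= ?big_nat_recr.
        by frames.
      move=> u hu.
      have hun : u < n by lia.
      have qu := q_lt hun.
      have quv : (q u == q v) = (u == v).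
        by apply/eqP/eqP => [e|->] //; rewrite -(pfunKV p hun) e pfunKV.
      have uM : q u < M by lia.
      have vM : q v < M by lia.
      rewrite !(cell_set_reg, cell_set_cell) //=.
      rewrite quv; case: eqP => [->|ne]; first by rewrite big_nat_recr.
      by apply: C; lia.
    by rewrite /=.
  move=> s' [F [r30 _] r22 _ C]; split=> // j hj.
  by have := C (f j) (f_lt hj); rewrite pfunK // left_belowE.
by rewrite /=; lia.
Qed.

(** The factor resets the running sum when j + 1 opens a new block, for then every l <= j lies in an
    earlier block. *)
Lemma block_carry (F : nat -> nat) j :
  (\sum_(0 <= l < j) (l %/ B == j %/ B) * F l + F j) * ((j + 1) %/ B == j %/ B) =
  \sum_(0 <= l < j.+1) (l %/ B == j.+1 %/ B) * F l.
Proof.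
rewrite addn1; case: eqP => [->|ne]; first by rewrite muln1 big_nat_recr //= eqxx mul1n.
rewrite muln0 big_nat_cond big1 // => l /andP [/andP [_ hl] _].
have le1 : l %/ B <= j %/ B by apply: leq_div2r.
have le2 : j %/ B <= j.+1 %/ B by apply: leq_div2r.
by have -> : (l %/ B == j.+1 %/ B) = false by lia.
Qed.

Definition far_term c j :=
  left_below p B c j * (\sum_(0 <= l < j) block_above p B c l
     + \sum_(0 <= l < j) (l %/ B == j %/ B) * block_above p B c l).

Lemma run_far_sum s c acc : env s -> regs s 30 = acc %! W ->
  regs s 22 = (\sum_(0 <= u < n) (q u %/ B == c)) %! W ->
  (forall j, j < n -> cell s 6 j = left_below p B c j %! W /\
      cell s 7 j = (\sum_(0 <= u < (f j).+1) (q u %/ B == c)) %! W) ->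
  run far_sum s (n * 70 + 30)
  (fun s' => frame 22 9 s s' /\
    regs s' 30 = (acc + \sum_(0 <= j < n) far_term c j) %! W).
Proof.
move=> E racc rtot C; have [*] := E; have N0 := N_gt0.
pose I j s' := [/\ frame 22 9 s s', regs s' 26 = j /\ regs s' 22 = regs s 22,
  regs s' 27 = (\sum_(0 <= l < j) block_above p B c l) %! W,
  regs s' 28 = (\sum_(0 <= l < j) (l %/ B == j %/ B) * block_above p B c l) %! W &
  regs s' 30 = (acc + \sum_(0 <= j' < j) far_term c j') %! W].
apply: run_le; [apply: run_seq; eapply assign_small; [by evs | lia |] | ].
  apply: run_seq; eapply assign_small; [by evs | lia |].
  apply: run_seq; eapply assign_small; [by evs | lia |].
  apply: run_imp.
    apply: (run_for (W := W) W_def (I := I) (lo := 0) (hi := n) (T := 60)) => //; try lia.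
    - move=> j s' _ [F [rj _] _ _ _]; split=> //; have [*] := env_frame F isT isT E; by evs.
    - by split; rewrite /= ?/upd /= ?big_geq ?trunc0 ?addn0 //; frames.
    move=> j s1 /andP [_ hj] [F [r26 r22] r27 r28 r30]; rewrite rtot in r22.
    have E1 := env_frame F isT isT E; have [*] := E1.
    have [c6 c7] := C j hj.
    have d1 : (j + 1) %/ B <= j + 1 by apply: leq_div.
    have d2 : j %/ B <= j by apply: leq_div.
    apply: run_le; [apply: run_seq; eapply assign_mod | ].
    + eapply (ev_add W_def); first by evs.
      eapply (ev_mul W_def); last by evs.
      apply: (ev_cell (i := j) (v := left_below p B c j)); [done | by evs | lia | done | ].
      by rewrite F.2 ?c6 //; lia.
    + apply: run_seq; eapply assign_mod.
        eapply (@ev_sub w m W W_def _ _ _ (\sum_(0 <= u < (f j).+1) (q u %/ B == c))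
          (block_above p B c j)).
          by apply: ev_reg; rewrite -block_total.
        apply: (ev_cell (i := j)); [done | by evs | lia | done | ].
        by rewrite cell_set_reg F.2 ?c7 //; lia.
      apply: run_seq; eapply assign_mod; first by evs.
      eapply assign_mod; first by evs.
      split=> //; split=> //; try by rewrite /= ?/upd /= ?big_nat_recr.
      * by frames.
      * by rewrite /= /upd /= r22.
      * by rewrite /= /upd /= block_carry.
      * by rewrite /= /upd /= big_nat_recr //= addnA.
    by rewrite /=.
  by move=> s' [F _ _ _ C'].
by rewrite /=; lia.
Qed.

Lemma run_far s : env s ->
  run far s t_far (fun s' => frame 20 6 s s' /\ regs s' 30 = far_pairs p B %! W).
Proof.
move=> E; have [*] := E; have N0 := N_gt0.
pose I c s' := [/\ frame 20 6 s s', regs s' 21 = c &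
  regs s' 30 = (\sum_(0 <= c' < c) \sum_(0 <= j < n) far_term c' j) %! W].
apply: run_le; [apply: run_seq; eapply assign_small; [by evs | lia |] | ].
  apply: run_seq; eapply assign_small; [by evs | lia |].
  apply: run_imp.
    apply: (run_for (W := W) W_def (I := I) (lo := 0) (hi := B)
      (T := (n * 60 + 30) + (n * 70 + 30))) => //; try lia.
    - move=> j s' _ [F rj _]; split=> //; have [*] := env_frame F isT isT E; by evs.
    - by split; rewrite /= ?/upd /= ?big_geq ?trunc0 ?addn0 //; frames.
    move=> c s1 /andP [_ hc] [F r21 r30].
    have E1 := env_frame F isT isT E.
    apply: run_seq; apply: run_imp; first exact: (run_far_ranks E1 r21 hc).
    move=> s2 [F2 r30' r22 C]; have E2 := env_frame F2 isT isT E1; rewrite r30 in r30'.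
    apply: run_imp; first exact: (run_far_sum E2 r30' r22 C).
    move=> s3 [F3 r30''].
    have F13 : frame 22 6 s1 s3.
      by apply: frame_trans F2 _; apply: frame_weak F3 _ _.
    split; first by rewrite F13.1.
    split=> //; last by rewrite /= /upd /= big_nat_recr.
    apply: frame_set_reg => //; apply: frame_trans F _; exact: frame_weak F13 _ _.
  by move=> s' [F _ C]; split=> //; rewrite C.
by rewrite /= /t_far; lia.
Qed.

Lemma tree_ext a a' s : a =1 a' -> tree a s -> tree a' s.
Proof.
move=> e t u hu; rewrite t //; congr (_ %! _).
by apply: eq_bigr => y _; rewrite e.
Qed.

Definition t_near_queries := B * (t_tree + 30) + 30.

Lemma run_near_queries s a j acc :
  env s -> regs s 22 = j -> j < n -> tree a s -> regs s 30 = acc %! W ->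
  run near_queries s t_near_queries (fun s' => frame 23 9 s s' /\
    regs s' 30 = (acc + \sum_(j %/ B * B <= l < j) \sum_((f l).+1 <= z < N) a z) %! W).
Proof.
move=> E rj hj t racc; have [*] := E; have N0 := N_gt0.
have lo_j : j %/ B * B <= j by apply: leq_trunc_div.
have d_j : j %/ B <= j by apply: leq_div.
pose I l s' := [/\ frame 23 9 s s', regs s' 23 = l &
  regs s' 30 = (acc + \sum_(j %/ B * B <= l' < l) \sum_((f l').+1 <= z < N) a z) %! W].
apply: run_le; [apply: run_seq; eapply assign_small; [by evs | lia |] | ].
  apply: run_imp.
    apply: (run_for (W := W) W_def (I := I) (lo := j %/ B * B) (hi := j)
      (T := t_tree + 20)) => //; try lia.
    - move=> l s' _ [F rl _]; split=> //; have [*] := env_frame F isT isT E.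
      have r22 : regs s' 22 = j by rewrite F.1.
      by evs.
    - by split; rewrite /= ?/upd /= ?big_geq ?addn0 //; frames.
    move=> l s1 /andP [lo_l hl] [F r23 r30].
    have E1 := env_frame F isT isT E; have [*] := E1.
    have hln : l < n by lia.
    have fl := f_lt hln.
    apply: run_le; [apply: run_seq; eapply (@run_assign_small w m W _ _ _ (f l)); [| |] | ].
    + by apply: (ev_cell (i := l)) => //; [by evs | lia | rewrite trunc_small; [auto | lia]].
    + by lia.
    + apply: run_seq; apply: run_imp.
        apply: (@run_query (set_reg s1 40 (f l)) a (f l)) => //; first by lia.
        by move=> u hu; rewrite cell_set_reg F.2 ?t //; lia.
      move=> s2 [F2 r44].
      have F12 : frame 40 9 s1 s2.
        apply: (@frame_trans _ _ _ (set_reg s1 40 (f l))); last by apply: frame_weak F2 _ _.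
        by frames.
      have r30' : regs s2 30 = regs s1 30 by rewrite F12.1.
      have r23' : regs s2 23 = regs s1 23 by rewrite F12.1.
      rewrite r30 in r30'; eapply assign_mod; first by evs.
      split; first by rewrite /= /upd /= r23'.
      split=> //; last by rewrite /= /upd /= big_nat_recr //= addnA.
      by frames; apply: frame_trans F _; apply: frame_weak F12 _ _.
    by rewrite /=; lia.
  by move=> s' [F _ C].
rewrite /= /t_near_queries.
have : j - j %/ B * B <= B by have := ltn_pmod j B_gt0; rewrite {2}(divn_eq j B); lia.
set x := j - _ => hx.
have : x * (1 + (t_tree + 20) + 7) <= B * (t_tree + 30) by apply: leq_mul => //; lia.
lia.
Qed.

Lemma min_expr x y : (x < y) * x + (y < x + 1) * y = minn x y.
Proof. by rewrite /minn addn1 ltnS; case: ltnP => /=; lia. Qed.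

Definition t_near_insertions := B * (t_tree + 30) + 60.

Lemma run_near_insertions s a j :
  env s -> regs s 22 = j -> j < n -> tree a s ->
  run near_insertions s t_near_insertions (fun s' => [/\ frame 23 8 s s',
    regs s' 30 = regs s 30 &
    tree (fun z => a z + \sum_(j.+1 <= i < block_end n B j) (f i == z)) s']).
Proof.
move=> E rj hj t; have [*] := E; have N0 := N_gt0.
have d_j : j %/ B <= j by apply: leq_div.
have lo_j : j %/ B * B <= j by apply: leq_trunc_div.
have he : j < block_end n B j by rewrite /block_end leq_min hj ltn_ceil.
have heB : block_end n B j <= j.+1 + B by apply: leq_trans (geq_minr _ _) _; lia.
have hen : block_end n B j <= n by apply: geq_minl.
pose I i s' := [/\ frame 23 8 s s', regs s' 30 = regs s 30,
  [/\ regs s' 26 = i, regs s' 25 = block_end n B j & regs s' 41 = 1 %! W] &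
  tree (fun z => a z + \sum_(j.+1 <= i' < i) (f i' == z)) s'].
apply: run_le; [apply: run_seq; eapply assign_small; [by evs | lia |] | ].
  apply: run_seq; eapply (@run_assign_small w m W _ _ _ (block_end n B j)); [| lia | ].
    apply: ev_eqv; first by evs.
    by rewrite /block_end -min_expr addn1.
  apply: run_seq; eapply assign_mod; [by evs |].
  apply: run_seq; eapply assign_small; [by evs | lia |].
  apply: run_imp.
    apply: (run_for (W := W) W_def (I := I) (lo := j + 1) (hi := block_end n B j)
      (T := t_tree + 20)) => //; try lia.
    - move=> i s' _ [F _ [r26 r25 _] _]; split=> //; by evs.
    - split=> //; first by frames.
      apply: tree_ext (t : tree a _) => z; rewrite addn1 big_geq //; lia.
    move=> i s1 /andP [lo_i hi] [F r30 [r26 r25 r41] t1].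
    have E1 := env_frame F isT isT E; have [*] := E1.
    have hin : i < n by lia.
    have fi := f_lt hin.
    apply: run_le; [apply: run_seq; eapply (@run_assign_small w m W _ _ _ (f i)); [| |] | ].
    + by apply: (ev_cell (i := i)) => //; [by evs | lia | rewrite trunc_small; [auto | lia]].
    + by lia.
    + apply: run_imp.
        apply: (@run_update (set_reg s1 40 (f i))
          (fun z => a z + \sum_(j.+1 <= i' < i) (f i' == z)) (f i) 1) => //.
        by lia.
      move=> s2 [F2 t2].
      have F12 : frame 40 8 s1 s2.
        apply: (@frame_trans _ _ _ (set_reg s1 40 (f i))); last by apply: frame_weak F2 _ _.
        by frames.
      split; first by rewrite F12.1.
      split.
      * by frames; apply: frame_trans F _; apply: frame_weak F12 _ _.
      * by rewrite /= /upd /= F12.1.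
      * by split=> //; rewrite /= /upd /= ?(F12.1 25) // F2.1.
      move=> u hu; rewrite cell_set_reg t2 //; congr (_ %! _); apply: eq_bigr => z _.
      rewrite big_nat_recr /= ?muln1 ?addnA; last by lia.
      by rewrite [z == _]eq_sym.
    by rewrite /=; lia.
  by move=> s' [F r30 _ C].
rewrite /= /t_near_insertions.
set x := block_end n B j - _; have hx : x <= B by rewrite /x; lia.
have : x * (1 + (t_tree + 20) + 7) <= B * (t_tree + 30) by apply: leq_mul => //; lia.
lia.
Qed.

Definition t_near := t_clear + n * (t_near_queries + t_near_insertions + 30) + 30.

Lemma run_near s : env s ->
  run near s t_near (fun s' => frame 20 8 s s' /\ regs s' 30 = near_pairs p B N %! W).
Proof.
move=> E; have [*] := E; have N0 := N_gt0.
pose I v s' := [/\ frame 20 8 s s', regs s' 21 = v, tree (inserted p B v) s' &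
  regs s' 30 = (\sum_(0 <= v' < v) \sum_(q v' %/ B * B <= l < q v')
    \sum_((f l).+1 <= z < N) inserted p B v' z) %! W].
apply: run_le; [apply: run_seq; apply: run_imp; first exact: run_clear | ].
  move=> s1 [F1 t1].
  apply: run_seq; eapply assign_small; [by evs | lia |].
  apply: run_seq; eapply assign_small; [by evs | lia |].
  apply: run_imp.
    apply: (run_for (W := W) W_def (I := I) (lo := 0) (hi := n)
      (T := t_near_queries + t_near_insertions + 20)) => //; try lia.
    - move=> j s' _ [F rj _ _]; split=> //; have [*] := env_frame F isT isT E; by evs.
    - split=> //; try by frames.
        apply: tree_ext (t1 : tree (fun=> 0) _) => z; by rewrite /inserted big_geq.
      by rewrite /= /upd /= big_geq // trunc0.
    move=> v s2 /andP [_ hv] [F r21 t r30].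
    have E2 := env_frame F isT isT E; have [*] := E2; have qv := q_lt hv.
    apply: run_le; [apply: run_seq; eapply (@run_assign_small w m W _ _ _ (q v)); [| |] | ].
    + by apply: (ev_cell (i := v)) => //; [by evs | lia | rewrite trunc_small; [auto | lia]].
    + by lia.
    + set s3 := set_reg _ _ _.
      have F23 : frame 22 9 s2 s3 by rewrite /s3; frames.
      have E3 := env_frame F23 isT isT E2.
      apply: run_seq; apply: run_imp.
        apply: (@run_near_queries s3 (inserted p B v) (q v) _ E3) => //.
        exact: r30.
      move=> s4 [F34 r30'].
      have E4 := env_frame F34 isT isT E3.
      have r22' : regs s4 22 = q v by rewrite F34.1.
      apply: run_imp; first apply: (@run_near_insertions s4 (inserted p B v) (q v) E4) => //.
        by apply: tree_frame F34 _; exact: t.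
      move=> s5 [F45 r30'' t5].
      have F25 : frame 22 8 s2 s5.
        apply: (@frame_trans _ _ _ s3); first by apply: frame_weak F23 _ _.
        by apply: (@frame_trans _ _ _ s4); [apply: frame_weak F34 _ _ | apply: frame_weak F45 _ _].
      split; first by rewrite F25.1.
      split=> //.
      * by frames; apply: frame_trans F _; apply: frame_weak F25 _ _.
      * apply: tree_ext (t5 : tree _ _) => z; by rewrite /inserted big_nat_recr.
      by rewrite /= /upd /= r30'' r30' big_nat_recr.
    by rewrite /=; lia.
  by move=> s' [F _ _ C]; split=> //; rewrite C.
by rewrite /= /t_near; lia.
Qed.

Lemma run_invert s :
  regs s 0 = n -> regs s 1 = N -> regs s 2 = L.+1 -> regs s 3 = M -> regs s 4 = B ->
  (forall i, i < n -> cell s 0 i = f i) -> run invert s (n * 30 + 30) env.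
Proof.
move=> r0 r1 r2 r3 r4 c0; have N0 := N_gt0.
pose I j s' := [/\ frame 20 1 s s', regs s' 20 = j &
  forall i, i < j -> cell s' 1 (f i) = i].
apply: run_le; [apply: run_seq; eapply assign_small; [by evs | lia |] | ].
  apply: run_imp.
    apply: (run_for (W := W) W_def (I := I) (lo := 0) (hi := n) (T := 20)) => //; try lia.
    - move=> j s' _ [F rj _]; split=> //.
      have r0' : regs s' 0 = n by rewrite F.1.
      by evs.
    - by split=> //; frames.
    move=> j s1 /andP [_ hj] [F r20 C]; have fj := f_lt hj.
    have r3' : regs s1 3 = M by rewrite F.1.
    apply: run_le; [eapply (run_store (i := f j) (v := j)); [done | | by evs | lia | done | ] | ].
    + apply: (ev_cell (i := j)) => //; [by evs | lia |].
      by rewrite trunc_small; [rewrite F.2 ?c0 //; lia | lia].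
    + split=> //; split=> //; first by frames.
      move=> i hi; have hin : i < n by lia.
      have fi := f_lt hin.
      have fM : f i < M by lia.
      have fM' : f j < M by lia.
      rewrite cell_set_reg cell_set_cell // eqxx /= trunc_small; last by lia.
      have -> : (f i == f j) = (i == j).
        by apply/eqP/eqP => [e|->] //; rewrite -(pfunK p hin) e pfunK.
      by case: eqP => [->|ne] //; apply: C; lia.
    by rewrite /=.
  move=> s' [F _ C]; split; rewrite ?F.1 //.
    by move=> i hi; rewrite F.2 ?c0 //; lia.
  by move=> i hi; rewrite -{1}(pfunKV p hi) C ?q_lt.
by rewrite /=; lia.
Qed.

Record ready (s : state) : Prop := Ready {
  ready_env : env s;
  ready_inv : forall i, i < n -> cell s 2 i = kind_val n f Inv i %! W;
  ready_x : forall i, i < n -> cell s 3 i = inv_sum n f (kind_val n f Pos) i %! W;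
  ready_y : forall i, i < n -> cell s 4 i = inv_sum n f (kind_val n f Val) i %! W;
  ready_v : forall i, i < n -> cell s 5 i = inv_sum n f (kind_val n f Inv) i %! W;
  ready_far : regs s 5 = far_pairs p B %! W;
  ready_near : regs s 6 = near_pairs p B N %! W }.

Lemma ev_kind s k i : env s -> i < n -> regs s 20 = i ->
  (forall i, i < n -> cell s 2 i = kind_val n f Inv i %! W) ->
  ev s (kind_expr k) (kind_val n f k i).
Proof.
move=> E hi r20 c2; have [*] := E; have N0 := N_gt0; case: k.
- exact: (ev_const _ W_def).
- by apply: ev_reg_small => //=; lia.
- by apply: ev_reg_small => //=; lia.
- apply: (ev_cell (i := i)); [done | by evs | lia | done |].
  by rewrite trunc_small; [auto | have := f_lt hi; rewrite /=; lia].
- by apply: (ev_cell (i := i)); [done | by evs | lia | done | exact: c2].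
Qed.

Definition t_arrays := t_sweep (kind_expr One) + t_sweep (kind_expr Pos)
  + t_sweep (kind_expr Val) + t_sweep (kind_expr Inv) + t_far + t_near + 10.

Lemma run_arrays s : env s -> run arrays s t_arrays ready.
Proof.
move=> E; have N0 := N_gt0.
apply: run_le; [apply: run_seq; apply: run_imp; first apply: (@run_sweep s 2 _ (fun=> 1) E isT) | ].
- by move=> s' i _ _ _; exact: (ev_const _ W_def).
- move=> s1 [F1 c2]; have E1 := env_frame F1 isT isT E.
  apply: run_seq; apply: run_imp; first apply: (@run_sweep s1 3 _ (kind_val n f Pos) E1 isT).
    move=> s' i hi F r; apply: ev_kind => //; first exact: env_frame F _ _ E1.
    by move=> j hj; rewrite F.2 ?c2 //; lia.
  move=> s2 [F2 c3]; have E2 := env_frame F2 isT isT E1.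
  apply: run_seq; apply: run_imp; first apply: (@run_sweep s2 4 _ (kind_val n f Val) E2 isT).
    move=> s' i hi F r; apply: ev_kind => //; first exact: env_frame F _ _ E2.
    by move=> j hj; rewrite F.2 ?F2.2 ?c2 //; lia.
  move=> s3 [F3 c4]; have E3 := env_frame F3 isT isT E2.
  apply: run_seq; apply: run_imp; first apply: (@run_sweep s3 5 _ (kind_val n f Inv) E3 isT).
    move=> s' i hi F r; apply: ev_kind => //; first exact: env_frame F _ _ E3.
    by move=> j hj; rewrite F.2 ?F3.2 ?F2.2 ?c2 //; lia.
  move=> s4 [F4 c5]; have E4 := env_frame F4 isT isT E3.
  apply: run_seq; apply: run_imp; first exact: (run_far E4).
  move=> s5 [F5 r5]; have E5 := env_frame F5 isT isT E4.
  apply: run_seq; eapply assign_mod; first by apply: ev_reg; exact: r5.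
  set s6 := set_reg _ _ _.
  have F6 : frame 5 9 s5 s6 by rewrite /s6; frames.
  have E6 := env_frame F6 isT isT E5.
  apply: run_seq; apply: run_imp; first exact: (run_near E6).
  move=> s7 [F7 r7]; have E7 := env_frame F7 isT isT E6.
  eapply assign_mod; first by apply: ev_reg; exact: r7.
  split.
  + by apply: (env_frame (b := 6) (a := 9) _ isT isT E7); frames.
  + by move=> i hi; rewrite cell_set_reg F7.2 ?cell_set_reg ?F5.2 ?F4.2 ?F3.2 ?F2.2 ?c2 //; lia.
  + by move=> i hi; rewrite cell_set_reg F7.2 ?cell_set_reg ?F5.2 ?F4.2 ?F3.2 ?c3 //; lia.
  + by move=> i hi; rewrite cell_set_reg F7.2 ?cell_set_reg ?F5.2 ?F4.2 ?c4 //; lia.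
  + by move=> i hi; rewrite cell_set_reg F7.2 ?cell_set_reg ?F5.2 ?c5 //; lia.
  + by rewrite /= /upd /= F7.1.
  + by [].
by rewrite /= /t_arrays /=; lia.
Qed.

Lemma ev_lin s X cs (F : stat -> nat) :
  (forall st, ev s (X st) (F st)) -> ev s (lin_expr X cs) (combine cs F).
Proof.
move=> H; rewrite /lin_expr /combine; elim: (zip cs stats) => [|x l IH] /=.
  exact: (ev_const _ W_def).
by eapply (ev_add W_def) => //; eapply (ev_mul W_def) => //; exact: (ev_const _ W_def).
Qed.

Lemma combine_add cs (F G : stat -> nat) :
  combine cs (fun st => F st + G st) = combine cs F + combine cs G.
Proof.
rewrite /combine; elim: (zip cs stats) => //= x l ->.
by rewrite mulnDr addnACA.
Qed.

Lemma combine0 cs : combine cs (fun=> 0) = 0.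
Proof. by rewrite /combine; elim: (zip cs stats) => //= x l ->; rewrite muln0. Qed.

Definition point_val (i : nat) (st : stat) : nat :=
  match st with
  | Path k g => kind_val n f k i * inv_sum n f (kind_val n f g) i
  | Star k1 k2 k3 => kind_val n f k1 i * kind_val n f k2 i * kind_val n f k3 i
  | _ => 0
  end.

Definition closed_val (st : stat) : nat :=
  match st with
  | Cyc => far_pairs p B + near_pairs p B N
  | Sq => (\sum_(0 <= i < n) kind_val n f Inv i) * (\sum_(0 <= i < n) kind_val n f Inv i)
  | _ => 0
  end.

Lemma stat_val_split cs : combine cs (stat_val n f) =
  combine cs (fun st => \sum_(0 <= i < n) point_val i st) + combine cs closed_val.
Proof.
rewrite -combine_add; apply: eq_combine => -[||k g|k1 k2 k3] /=; rewrite ?big1_eq ?addn0 //.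
by rewrite add0n (cyc_split p B_gt0 nB nN).
Qed.

Lemma ev_point s st i : ready s -> i < n -> regs s 20 = i -> ev s (point_expr st) (point_val i st).
Proof.
move=> [E c2 c3 c4 c5 _ _] hi r20; have [*] := E; have N0 := N_gt0.
have K k := @ev_kind s k i E hi r20 c2.
have iE : ev s (Reg 20) i by evs.
case: st => [||k g|k1 k2 k3]; try exact: (ev_const _ W_def).
  eapply (ev_mul W_def) => //; case: g.
  - by apply: (ev_cell (i := i)) => //; [lia | exact: c2].
  - apply: (@ev_eqv _ _ _ _ _ (n * kind_val n f Inv i)).
      eapply (ev_mul W_def); first by evs.
      by apply: (ev_cell (i := i)) => //; [lia | exact: c2].
    rewrite /= /inv_sum big_distrr; apply: eq_bigr => l _ /=.
    by rewrite muln1 mulnC.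
  - by apply: (ev_cell (i := i)) => //; [lia | exact: c3].
  - by apply: (ev_cell (i := i)) => //; [lia | exact: c4].
  - by apply: (ev_cell (i := i)) => //; [lia | exact: c5].
by eapply (ev_mul W_def) => //; eapply (ev_mul W_def).
Qed.

Definition t_totals pos neg :=
  n * (ecost (lin_expr point_expr pos) + ecost (lin_expr point_expr neg) + 40)
  + ecost (lin_expr closed_expr pos) + ecost (lin_expr closed_expr neg) + 60.

Lemma ready_frame s s' : frame 7 9 s s' -> ready s -> ready s'.
Proof.
move=> F [E *]; have N0 := N_gt0; split; first exact: env_frame F _ _ E.
- by move=> i hi; rewrite F.2 //; [auto | lia].
- by move=> i hi; rewrite F.2 //; [auto | lia].
- by move=> i hi; rewrite F.2 //; [auto | lia].
- by move=> i hi; rewrite F.2 //; [auto | lia].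
- by rewrite F.1.
- by rewrite F.1.
Qed.

(** Both totals may have wrapped around, but their difference 12 x fits in a word, so the division
    by 12 is exact. *)
Lemma run_totals s pos neg x : ready s -> 12 * x < W ->
  combine pos (stat_val n f) = combine neg (stat_val n f) + 12 * x ->
  run (totals pos neg) s (t_totals pos neg) (fun s' => regs s' 0 = x).
Proof.
move=> Rd hx; rewrite !stat_val_split => total.
have N0 := N_gt0; have [*] := ready_env Rd.
pose I j s' := [/\ frame 7 9 s s', regs s' 20 = j,
  regs s' 7 = combine pos (fun st => \sum_(0 <= i < j) point_val i st) %! W,
  regs s' 8 = combine neg (fun st => \sum_(0 <= i < j) point_val i st) %! W &
  regs s' 9 = (\sum_(0 <= i < j) kind_val n f Inv i) %! W].
have I0 cs : combine cs (fun st => \sum_(0 <= i < 0) point_val i st) = 0.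
  by rewrite -[RHS](combine0 cs); apply: eq_combine => st; rewrite big_geq.
have IS cs j : combine cs (fun st => \sum_(0 <= i < j.+1) point_val i st) =
    combine cs (fun st => \sum_(0 <= i < j) point_val i st) + combine cs (point_val j).
  by rewrite -combine_add; apply: eq_combine => st; rewrite big_nat_recr.
apply: run_le; [apply: run_seq; eapply assign_small; [by evs | lia |] | ].
  apply: run_seq; eapply assign_small; [by evs | lia |].
  apply: run_seq; eapply assign_small; [by evs | lia |].
  apply: run_seq; eapply assign_small; [by evs | lia |].
  apply: run_seq; apply: run_imp.
    apply: (run_for (W := W) W_def (I := I) (lo := 0) (hi := n)
      (T := ecost (lin_expr point_expr pos) + ecost (lin_expr point_expr neg) + 20)) => //; try lia.
    - move=> j s' _ [F rj _ _ _]; split=> //.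
      by have [*] := env_frame F isT isT (ready_env Rd); evs.
    - by split; rewrite /= ?/upd /= ?I0 ?big_geq ?trunc0 //; frames.
    move=> j s1 /andP [_ hj] [F r20 r7 r8 r9].
    have R1 := ready_frame F Rd; have [*] := ready_env R1.
    apply: run_le; [apply: run_seq; eapply assign_mod | ].
    + eapply (ev_add W_def); first by evs.
      by apply: (@ev_lin _ _ _ (point_val j)) => st; exact: ev_point.
    + set s2 := set_reg _ _ _.
      have F2 : frame 7 9 s s2 by rewrite /s2; frames.
      have R2 := ready_frame F2 Rd.
      apply: run_seq; eapply assign_mod.
        eapply (ev_add W_def); first by apply: ev_reg; exact: r8.
        by apply: (@ev_lin _ _ _ (point_val j)) => st; exact: ev_point.
      set s3 := set_reg _ _ _.
      have F3 : frame 7 9 s s3 by rewrite /s3; frames.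
      have R3 := ready_frame F3 Rd.
      have [*] := ready_env R3.
      eapply assign_mod.
        eapply (ev_add W_def); first by apply: ev_reg; exact: r9.
        apply: (ev_cell (i := j) (v := kind_val n f Inv j)) => //; [by evs | lia |].
        exact: ready_inv.
      split=> //; split; rewrite /= ?/upd /= ?IS ?big_nat_recr //; frames.
    by rewrite /=; lia.
  move=> s1 [F r20 r7 r8 r9]; have R1 := ready_frame F Rd.
  have closed s' st : frame 7 9 s1 s' -> regs s' 9 = regs s1 9 ->
      ev s' (closed_expr st) (closed_val st).
    move=> F' e9; case: st => [||k g|k1 k2 k3]; try exact: (ev_const _ W_def).
      eapply (ev_add W_def); apply: ev_reg; rewrite F'.1 //; first exact: ready_far.
      exact: ready_near.
    by eapply (ev_mul W_def); apply: ev_reg; rewrite e9.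
  apply: run_seq; eapply assign_mod.
    eapply (ev_add W_def); first by apply: ev_reg; exact: r7.
    by apply: (@ev_lin _ _ _ closed_val) => st; apply: closed.
  apply: run_seq; eapply assign_mod.
    eapply (ev_add W_def); first by apply: ev_reg; exact: r8.
    by apply: (@ev_lin _ _ _ closed_val) => st; apply: closed => //; frames.
  eapply (@run_assign_small w m W _ _ _ (12 * x %/ 12)).
  - eapply (ev_div W_def); last 2 first.
    + exact: hx.
    + by lia.
    + eapply (ev_sub W_def); last by apply: ev_reg; rewrite /= /upd /=.
      by apply: ev_reg; rewrite /= /upd /= total.
    exact: (ev_const _ W_def).
  - by rewrite mulKn //; lia.
  by rewrite mulKn.
by rewrite /= /t_totals; lia.
Qed.
End Routines.

(** * Parameters of the program and its assembly *)

Lemma sqrt_up_exists n : exists b, (0 < b) && (n <= b * b).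
Proof. by exists n.+1; nia. Qed.

(** Kept positive even for n = 0, because the block length serves as a divisor. *)
Definition sqrt_up n : nat := ex_minn (sqrt_up_exists n).

Lemma sqrt_upP n : [/\ 0 < sqrt_up n, n <= sqrt_up n * sqrt_up n &
  forall b, 0 < b -> (b * b < n) = (b < sqrt_up n)].
Proof.
rewrite /sqrt_up; case: ex_minnP => B /andP [B0 nB] Bmin; split=> // b b0.
apply/idP/idP => [lt|]; first by rewrite ltnNge; apply/negP => le; nia.
by apply: contraLR; rewrite -!leqNgt => le; apply: Bmin; rewrite b0.
Qed.

Lemma sqrt_up_leS n : sqrt_up n <= n.+1.
Proof. by rewrite /sqrt_up; case: ex_minnP => B _; apply; nia. Qed.

Lemma exp_lt_up_log n e : (2 ^ e < n) = (e < up_log 2 n).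
Proof.
apply/idP/idP => [lt|].
  rewrite ltnNge; apply/negP => le; move: lt; rewrite ltnNge => /negP; apply.
  by apply: leq_trans (up_logP n (isT : 1 < 2)) _; rewrite leq_exp2l.
by apply: contraLR; rewrite -!leqNgt => le; apply: up_log_min.
Qed.

Lemma exp_up_log_le n : 2 ^ up_log 2 n <= 2 * n + 1.
Proof.
case E: (up_log 2 n) => [|l]; first by lia.
have : 2 ^ l < n by rewrite exp_lt_up_log E.
by rewrite expnS; lia.
Qed.

Lemma up_log_leS n : up_log 2 n <= n.
Proof. by apply: up_log_min => //; apply: ltnW; apply: ltn_expl. Qed.

(** Each search runs for n rounds and moves only while its test holds, so it stops changing once the
    target is reached. The rounds suffice since [up_log 2 n] is at most n and [sqrt_up n] at most n
    + 1. *)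
Definition init : cmd :=
  Assign 1 (Const 1) ;;
  Assign 2 (Const 1) ;;
  Assign 20 (Const 0) ;;
  For 20 (Reg 0)
    (Assign 2 (Bin Add (Reg 2) (Bin Lt (Reg 1) (Reg 0))) ;;
     Assign 1 (Bin Add (Reg 1) (Bin Mul (Reg 1) (Bin Lt (Reg 1) (Reg 0))))) ;;
  Assign 3 (Bin Mul (Const 2) (Reg 1)) ;;
  Assign 4 (Const 1) ;;
  Assign 20 (Const 0) ;;
  For 20 (Reg 0)
    (Assign 4 (Bin Add (Reg 4) (Bin Lt (Bin Mul (Reg 4) (Reg 4)) (Reg 0)))).

Definition count_cmd (sigma : 'S_4) : cmd :=
  init ;; invert ;; arrays ;; totals (pos_row (word sigma)) (neg_row (word sigma)).

Definition count_time (sigma : 'S_4) (n : nat) : nat :=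
  (n * 80 + 80) + (n * 30 + 30) + t_arrays n (up_log 2 n) (sqrt_up n)
  + t_totals n (pos_row (word sigma)) (neg_row (word sigma)).

Definition count_space (n : nat) : nat := 9 * (2 * 2 ^ up_log 2 n).

Section Init.
Variables (w m W : nat).
Hypothesis W_def : 2 ^ w = W.
Local Notation assign_small := (@run_assign_small w m W _ _ _ _ _).

Ltac evs := ev_solve W_def.

Lemma run_init n s : regs s 0 = n -> 4 * (n.+2 * n.+2) < W ->
  run w m init s (n * 80 + 80) (fun s' =>
    [/\ regs s' 0 = n /\ regs s' 1 = 2 ^ up_log 2 n, regs s' 2 = (up_log 2 n).+1,
        regs s' 3 = 2 * 2 ^ up_log 2 n, regs s' 4 = sqrt_up n & Defs.mem s' = Defs.mem s]).
Proof.
move=> r0 hW; set L := up_log 2 n.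
have hL : L <= n := up_log_leS n.
have hN : 2 ^ L <= 2 * n + 1 := exp_up_log_le n.
have [B0 nB Blt] := sqrt_upP n; have hB := sqrt_up_leS n.
pose I j s' := [/\ regs s' 0 = n, regs s' 20 = j, regs s' 1 = 2 ^ minn j L,
  regs s' 2 = (minn j L).+1 & Defs.mem s' = Defs.mem s].
pose J j s' := [/\ regs s' 0 = n /\ regs s' 1 = 2 ^ L, regs s' 20 = j,
  regs s' 2 = L.+1 /\ regs s' 3 = 2 * 2 ^ L,
  regs s' 4 = minn j.+1 (sqrt_up n) & Defs.mem s' = Defs.mem s].
apply: run_le; [apply: run_seq; eapply assign_small; [by evs | lia |] | ].
  apply: run_seq; eapply assign_small; [by evs | lia |].
  apply: run_seq; eapply assign_small; [by evs | lia |].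
  apply: run_seq; apply: run_imp.
    apply: (run_for (W := W) W_def (I := I) (lo := 0) (hi := n) (T := 20)) => //; try lia.
    - by move=> j s' _ [r0' rj _ _ _]; split=> //; evs.
    - by split; rewrite //= ?/upd /= ?min0n.
    move=> j s1 /andP [_ hj] [r0' r20 r1 r2 e].
    have le1 : 2 ^ minn j L <= 2 ^ L by rewrite leq_exp2l // geq_minr.
    have step : (2 ^ minn j L < n) = (j < L).
      by rewrite exp_lt_up_log -/L; lia.
    apply: run_le; [apply: run_seq; eapply assign_small; [by evs | lia |] | ].
      eapply assign_small; [by evs | | ].
        by case: (_ < n); lia.
      rewrite step; split=> //; split; rewrite //= ?/upd /=; last by lia.
      case: (ltnP j L) => hjL.
        by rewrite muln1 addnn -mul2n -expnS; congr (_ ^ _); lia.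
      by rewrite muln0 addn0; congr (_ ^ _); lia.
    by rewrite /=.
  move=> s1 [r0' _ r1 r2 e]; rewrite (minn_idPr hL) in r1 r2.
  apply: run_seq; eapply assign_small; [by evs | lia |].
  apply: run_seq; eapply assign_small; [by evs | lia |].
  apply: run_seq; eapply assign_small; [by evs | lia |].
  apply: run_imp.
    apply: (run_for (W := W) W_def (I := J) (lo := 0) (hi := n) (T := 20)) => //; try lia.
    - by move=> j s' _ [[r0'' _] rj _ _ _]; split=> //; evs.
    - by split; rewrite //= ?/upd /=; lia.
    move=> j s2 /andP [_ hj] [[r0'' r1'] r20 [r2' r3'] r4 e'].
    have bW : minn j.+1 (sqrt_up n) * minn j.+1 (sqrt_up n) < W by nia.
    have step : (minn j.+1 (sqrt_up n) * minn j.+1 (sqrt_up n) < n) = (j.+1 < sqrt_up n).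
      by rewrite Blt; lia.
    apply: run_le; [eapply assign_small; [by evs | lia |] | ].
      by rewrite step; split=> //; split; rewrite //= ?/upd /=; lia.
    by rewrite /=.
  by move=> s2 [[? ?] _ [? ?] r4 e']; split=> //; rewrite r4; lia.
by rewrite /=; lia.
Qed.
End Init.

Lemma occ_le n (p : 'S_n) (sigma : 'S_4) : occ sigma p <= n ^ 4.
Proof.
apply: leq_trans (max_card _) _.
by rewrite card_ffun !card_ord.
Qed.

Lemma count_computes (sigma : 'S_4) :
  computes_within (count_cmd sigma) (@occ 4 sigma) (count_time sigma) count_space.
Proof.
(* With P = 2^(l+1), l the binary logarithm of n, one has P > n and P >= 2. So W = P^12 is at least
   2^8 (n+1)^4, enough for 12 n^4 and for all addresses. *)
exists 12 => // n p.
set w := 12 * _; set W := 2 ^ w.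
have hW : 256 * n.+1 ^ 4 <= W.
  rewrite /W /w [12 * _]mulnC expnM; set P := 2 ^ _.+1.
  have P2 : 2 <= P by rewrite /P expnS; have := expn_gt0 2 (trunc_log 2 n); lia.
  have Pn : n.+1 <= P by rewrite /P; apply: trunc_log_ltn.
  rewrite mulnC -[12]/(4 + 8) expnD; apply: leq_mul; first by rewrite leq_exp2r.
  by apply: (@leq_trans (2 ^ 8)) => //; rewrite leq_exp2r.
have hN := exp_up_log_le n.
have n4 : n.+1 <= n.+1 ^ 4.
  by have := leq_pexp2l (ltn0Sn n) (isT : 1 <= 4); rewrite expn1.
have n2 : n.+1 * n.+1 <= n.+1 ^ 4 by rewrite mulnn leq_pexp2l.
have [B0 nB _] := sqrt_upP n; have hB := sqrt_up_leS n.
have nN : n <= 2 ^ up_log 2 n by apply: up_logP.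
have WM : 9 * (2 * 2 ^ up_log 2 n) < W by lia.
have W_def : 2 ^ w = W by [].
have hx : 12 * occ sigma p < W.
  have := occ_le p sigma; have : n ^ 4 <= n.+1 ^ 4 by rewrite leq_exp2r.
  lia.
suff [t [s' [h le r]]] : run w (count_space n) (count_cmd sigma) (init_state p)
    (count_time sigma n) (fun s' => regs s' 0 = occ sigma p) by exists t, s'.
apply: run_le; [apply: run_seq; apply: run_imp; first apply: (run_init _ W_def (n := n)) => // | ].
- by nia.
- move=> s1 [[r0 r1] r2 r3 r4 e1].
  apply: run_seq; apply: run_imp.
    apply: (run_invert W_def (p := p) (L := up_log 2 n) (B := sqrt_up n)) => //.
    by move=> i hi; rewrite /cell e1.
  move=> s2 E2; apply: run_seq; apply: run_imp; first apply: (run_arrays W_def) E2 => //.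
  move=> s3 R3; apply: (run_totals W_def) R3 _ _ => //.
  have := pattern_identity p sigma.
  by rewrite !(eq_combine _ (stat_countE p)).
by rewrite /count_time; lia.
Qed.

(** * Running time *)

(** All factors are positive, so lower-order terms are absorbed for every n, including 0 and 1. *)
Definition size_bound (n : nat) : nat := n.+1 * sqrt_up n * (up_log 2 n).+1.

Lemma count_time_le (sigma : 'S_4) :
  exists C, forall n, count_time sigma n <= C * size_bound n.
Proof.
set pos := pos_row (word sigma); set neg := neg_row (word sigma).
pose c1 := ecost (lin_expr point_expr pos) + ecost (lin_expr point_expr neg) + 40.
pose c2 := ecost (lin_expr closed_expr pos) + ecost (lin_expr closed_expr neg) + 60.
exists (60 * 60 + c1 + c2) => n.
have [b0 _ _] := sqrt_upP n; have hN := exp_up_log_le n.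
rewrite /count_time -/pos -/neg /t_totals.
have -> : n * (ecost (lin_expr point_expr pos) + ecost (lin_expr point_expr neg) + 40)
  + ecost (lin_expr closed_expr pos) + ecost (lin_expr closed_expr neg) + 60 = n * c1 + c2.
  by rewrite /c1 /c2; lia.
rewrite /t_arrays /t_sweep /t_far /t_near /t_near_queries /t_near_insertions /t_clear /t_tree.
rewrite /size_bound; clearbody c1 c2; move: hN.
move: (2 ^ _) => N; move: (up_log 2 n) => L; move: (sqrt_up n) b0 => b b0 hN.
have Z1 : 0 < n.+1 * b * L.+1 by rewrite !muln_gt0 b0.
have h1 : n * c1 <= c1 * (n.+1 * b * L.+1).
  rewrite mulnC leq_mul2l; apply/orP; right.
  by rewrite -mulnA; apply: leq_trans (leq_pmulr _ _); rewrite ?muln_gt0 ?b0.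
have h2 : c2 <= c2 * (n.+1 * b * L.+1) by rewrite leq_pmulr.
rewrite mulnDl mulnDl.
(* These inequalities between monomials make the remaining goal linear in the products. *)
have e1 : b * n <= b * n * L.+1 by rewrite leq_pmulr.
have e2 : n * L.+1 <= b * n * L.+1 by rewrite -mulnA leq_pmull.
have e3 : b <= b * L.+1 by rewrite leq_pmulr.
have e4 : L.+1 <= b * L.+1 by rewrite leq_pmull.
have e5 : n <= n * L.+1 by rewrite leq_pmulr.
rewrite /kind_expr /arr [ecost _]/= [ecost (Reg _)]/= [ecost (Read _)]/= [ecost (Read _)]/=.
lia.
Qed.

Lemma count_space_le n : count_space n <= 60 * size_bound n.
Proof.
have [b0 _ _] := sqrt_upP n; have hN := exp_up_log_le n.
rewrite /count_space /size_bound.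
have : n.+1 <= n.+1 * sqrt_up n * (up_log 2 n).+1.
  by rewrite -mulnA leq_pmulr // muln_gt0 b0.
lia.
Qed.

(** Minimality gives (b - 1)^2 < n for b = [sqrt_up n] >= 2, and b <= 2 (b - 1). *)
Lemma sqrt_up_sqr_le n : 0 < n -> sqrt_up n * sqrt_up n <= 4 * n.
Proof.
move=> n0; have [b0 _ lt] := sqrt_upP n.
case E: (sqrt_up n) => [|[|b]] //; first by lia.
have : b.+1 * b.+1 < n by rewrite lt // E.
nia.
Qed.
Local Open Scope ring_scope.

(** The constant is 2 * 2 * 3 / ln 2: a factor 2 for n + 1, 2 for the rounded root, and 3 / ln 2 for
    the logarithm, whose additive terms are absorbed by ln n >= ln 2. *)
Lemma size_bound_le (R : realType) (n : nat) : (2 <= n)%N ->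
  (size_bound n)%:R <= 12 / ln 2 * ((n%:R : R) `^ (3 / 2) * ln (n%:R : R) ^+ 1).
Proof.
move=> n2; have n0 : (0 < n)%N by apply: leq_trans n2.
have nR : 0 < n%:R :> R by rewrite ltr0n.
have ln2 : 0 < ln (2 : R) by apply: ln_gt0; rewrite ltr1n.
have lnn : ln (2 : R) <= ln (n%:R : R) by rewrite ler_ln ?posrE ?ltr0n // ler_nat.
have hL : ((up_log 2 n).+1)%:R <= 3 / ln 2 * ln (n%:R : R).
  have lt : (2 ^ (up_log 2 n).-1 < n)%N by apply: up_log_gtn.
  have : (up_log 2 n).-1%:R * ln (2 : R) <= ln (n%:R : R).
    rewrite mulrC mulr_natr -lnXn // ler_ln ?posrE ?exprn_gt0 ?ltr0n //.
    by rewrite -natrX ler_nat ltnW.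
  have L0 : (0 < up_log 2 n)%N by rewrite up_log_gt0.
  have -> : (up_log 2 n).+1 = ((up_log 2 n).-1 + 2)%N by lia.
  rewrite mulrAC ler_pdivlMr // natrD mulrDl => h.
  have -> : 3 * ln (n%:R : R) = ln (n%:R : R) + 2 * ln (n%:R : R).
    by rewrite -[3]/(1 + 2)%:R natrD mulrDl mul1r.
  by apply: lerD => //; rewrite ler_pM2l // ltr0n.
have hB : (sqrt_up n)%:R <= 2 * n%:R `^ 2^-1 :> R.
  rewrite powR12_sqrt ?ler0n // -(@ler_pXn2r _ 2) ?nnegrE ?mulr_ge0 ?ler0n ?sqrtr_ge0 //.
  rewrite exprMn sqr_sqrtr ?ler0n // -natrX -natrX -natrM ler_nat.
  by rewrite -mulnn; apply: sqrt_up_sqr_le.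
have -> : (n%:R : R) `^ (3 / 2) = n%:R * n%:R `^ 2^-1.
  rewrite -[3]/(1 + 2)%:R natrD mulrDl mul1r divff ?pnatr_eq0 // powRD.
    by rewrite powRr1 ?ler0n // mulrC.
  by apply/implyP => _; rewrite gt_eqF.
have h1 : n.+1%:R <= 2 * n%:R :> R by rewrite -natrM ler_nat; lia.
rewrite /size_bound !natrM expr1.
have -> : 12 / ln 2 * (n%:R * n%:R `^ 2^-1 * ln n%:R) =
    2 * n%:R * (2 * n%:R `^ 2^-1) * (3 / ln 2 * ln n%:R) :> R.
  by ring.
by apply: ler_pM; rewrite ?mulr_ge0 ?ler0n //; apply: ler_pM; rewrite ?ler0n.
Qed.

Lemma soft_O_size_bound (R : realType) (t : nat -> nat) (C : nat) :
  (forall n, (t n <= C * size_bound n)%N) ->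
  soft_O t (fun n : nat => (n%:R : R) `^ (3 / 2)).
Proof.
move=> tC; exists 1%N; apply/eqO_exP.
have ln2 : 0 < ln (2 : R) by apply: ln_gt0; rewrite ltr1n.
(* The successor of C keeps the constant positive. *)
exists (C.+1%:R * (12 / ln 2)); first by rewrite mulr_gt0 ?ltr0n // divr_gt0.
near=> n.
have n2 : (2 <= n)%N by near: n; exact: nbhs_infty_ge.
rewrite ger0_norm ?ler0n //.
have ge0 : 0 <= (n%:R : R) `^ (3 / 2) * ln (n%:R : R) ^+ 1.
  by rewrite mulr_ge0 ?powR_ge0 // expr1 ln_ge0 // ler1n ltnW.
rewrite ger0_norm // -mulrA.
apply: (@le_trans _ _ (C.+1%:R * (size_bound n)%:R)).
  by rewrite -natrM ler_nat; apply: leq_trans (tC n) _; rewrite leq_mul2r leqnSn orbT.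
by rewrite ler_pM2l ?ltr0n // size_bound_le.
Unshelve. all: by end_near.
Qed.

Theorem theorem7 (R : realType) (sigma : 'S_4) :
  exists (P : cmd) (time space : nat -> nat),
    [/\ soft_O time (fun n : nat => (n%:R : R) `^ (3 / 2)),
        soft_O space (fun n : nat => (n%:R : R) `^ (3 / 2))
      & computes_within P (@occ 4 sigma) time space].
Proof.
have [C hC] := count_time_le sigma.
exists (count_cmd sigma), (count_time sigma), count_space; split.
- exact: soft_O_size_bound hC.
- exact: soft_O_size_bound count_space_le.
- exact: count_computes.
Qed.
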